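(* Let $\mathcal M=(M,<,+,0,\ldots)$ be a definably complete locally o-minimal expansion of an ordered group and let $(X,\tau)$ be a definable topological space. The following are equivalent: (1) for every definable curve $\gamma:(a,b)\to X$ with $a\in M\cup\{-\infty\}$, $b\in M\cup\{\infty\}$, both $\operatorname{Conv}_{\mathrm{right}}(\gamma)$ and $\operatorname{Conv}_{\mathrm{left}}(\gamma)$ are nonempty; (2) every definable net in $X$ has a convergent definable subnet; (3) every definable filtered collection of nonempty closed subsets of $X$ has nonempty intersection.
   Context: ''Definable'' means definable in $\mathcal M$ with parameters. $\mathcal M$ is an expansion of an ordered group with dense order without endpoints; locally o-minimal: for every definable $Y\subseteq M$ and $a\in M$ there is an open interval $I\ni a$ with $Y\cap I$ a finite union of points and open intervals; definably complete: every definable subset of $M$ has sup and inf in $M\cup\{\pm\infty\}$. A family $\{S_t:t\in T\}$ is definable if $T$ and $\bigcup_t\{t\}\times S_t$ are definable; it is a filtered collection if for any two members some member lies in their intersection. A definable topological space is a definable set with a topology having a definable family as open base. A definable directed set is a definable nonempty set $\Omega$ with a definable preorder $\preceq$ such that every finite subset has a common lower bound. A definable net in $X$ is a definable map $\gamma:(\Omega,\preceq)\to X$ from a definable directed set; it converges to $x$ if for every definable neighborhood $A$ of $x$ there is $u_A$ with $\gamma(u)\in A$ whenever $u\preceq u_A$. A definable subnet of $\gamma$ is $\gamma\circ f$ where $f:(\Omega',\preceq')\to(\Omega,\preceq)$ is a definable map from a definable directed set which is downward cofinal (for each $u\in\Omega$ there is $v\in\Omega'$ with $w\preceq' v\Rightarrow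 f(w)\preceq u$). A definable curve is a definable (not necessarily continuous) map from an open interval. For $\gamma:(a,b)\to X$: $\operatorname{Conv}_{\mathrm{right}}(\gamma)$ is the set of $x\in X$ such that for every $t\in(a,b)$ and every definable neighborhood $A$ of $x$, $\gamma((t,b))\cap A\ne\emptyset$; $\operatorname{Conv}_{\mathrm{left}}(\gamma)$ is defined likewise with $\gamma((a,t))$. *)

(* Defs.v *)
(* Points of M^n are lists of length n; a "structure" on M in
   the sense of van den Dries (Tame Topology, Ch.1) is a family D n of subsets
   of M^n; D n A means "A is a definable (with parameters) subset of M^n". *)
From Stdlib Require Import List Arith.
Import ListNotations.

Set Implicit Arguments.

Definition pset (M : Type) := list M -> Prop.
Section Defs.
Variable M : Type.

Local Notation pset := (list M -> Prop).

Record is_structure (D : nat -> pset -> Prop) : Prop := {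
  st_ext : forall n (A B : pset), D n A -> (forall x, A x <-> B x) -> D n B;
  st_size : forall n (A : pset) x, D n A -> A x -> length x = n;
  st_full : forall n, D n (fun x => length x = n);
  st_compl : forall n (A : pset), D n A -> D n (fun x => length x = n /\ ~ A x);
  st_union : forall n (A B : pset), D n A -> D n B -> D n (fun x => A x \/ B x);
  st_prodl : forall n (A : pset), D n A ->
      D (S n) (fun x => exists a y, x = a :: y /\ A y);
  st_prodr : forall n (A : pset), D n A ->
      D (S n) (fun x => exists y a, x = y ++ [a] /\ A y);
  st_diag : forall n i j, i < n -> j < n ->
      D n (fun x => length x = n /\ nth_error x i = nth_error x j);
  st_proj : forall n (A : pset), D (S n) A -> D n (fun x => exists a, A (x ++ [a]))
}.

Inductive ebar := MInf | Fin (a : M) | PInf.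

Variable lt : M -> M -> Prop.

Definition elt (x y : ebar) : Prop :=
  match x, y with
  | MInf, MInf => False
  | MInf, _ => True
  | Fin a, Fin b => lt a b
  | Fin _, PInf => True
  | _, _ => False
  end.

Definition ele (x y : ebar) : Prop := elt x y \/ x = y.

Definition in_int (a b : ebar) (t : M) : Prop := elt a (Fin t) /\ elt (Fin t) b.

Variables (add : M -> M -> M) (zero : M) (opp : M -> M).

Definition is_dense_ordered_group : Prop :=
  (forall x, ~ lt x x) /\
  (forall x y z, lt x y -> lt y z -> lt x z) /\
  (forall x y, lt x y \/ x = y \/ lt y x) /\
  (forall x y z, add x (add y z) = add (add x y) z) /\
  (forall x y, add x y = add y x) /\
  (forall x, add x zero = x) /\
  (forall x, add x (opp x) = zero) /\
  (forall x y z, lt x y -> lt (add x z) (add y z)) /\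
  (forall x y, lt x y -> exists z, lt x z /\ lt z y) /\
  (forall x, exists y, lt y x) /\
  (forall x, exists y, lt x y).

Variable D : nat -> pset -> Prop.

Definition fin_union_pts_ints (Z : M -> Prop) : Prop :=
  exists (ps : list M) (ivs : list (ebar * ebar)),
    forall t, Z t <-> (In t ps \/ exists p, In p ivs /\ in_int (fst p) (snd p) t).

Definition locally_o_minimal : Prop :=
  forall (Y : pset) (a : M), D 1 Y ->
    exists l u : ebar, in_int l u a /\
      fin_union_pts_ints (fun t => Y [t] /\ in_int l u t).

Definition is_sup (Y : M -> Prop) (s : ebar) : Prop :=
  (forall y, Y y -> ele (Fin y) s) /\
  (forall u, (forall y, Y y -> ele (Fin y) u) -> ele s u).

Definition is_inf (Y : M -> Prop) (s : ebar) : Prop :=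
  (forall y, Y y -> ele s (Fin y)) /\
  (forall u, (forall y, Y y -> ele u (Fin y)) -> ele u s).

Definition definably_complete : Prop :=
  forall Y : pset, D 1 Y ->
    (exists s, is_sup (fun t => Y [t]) s) /\ (exists s, is_inf (fun t => Y [t]) s).

(* D is the collection of sets definable with parameters in a definably
   complete locally o-minimal expansion of the dense ordered group (M,<,+,0) *)
Definition DC_loc_omin_expansion : Prop :=
  is_dense_ordered_group /\
  is_structure D /\
  D 2 (fun x => exists a b, x = [a; b] /\ lt a b) /\
  D 3 (fun x => exists a b, x = [a; b; add a b]) /\
  (forall a, D 1 (fun x => x = [a])) /\
  locally_o_minimal /\
  definably_complete.

Definition def_family (m n : nat) (T : pset) (B : list M -> pset) : Prop :=
  D m T /\ D (m + n) (fun z => exists t x, z = t ++ x /\ T t /\ B t x).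

Definition def_map (k n : nat) (A Y : pset) (f : list M -> list M) : Prop :=
  D k A /\ (forall u, A u -> Y (f u)) /\
  D (k + n) (fun z => exists u, A u /\ z = u ++ f u).

Definition is_topology (X : pset) (tau : pset -> Prop) : Prop :=
  (forall U, tau U -> forall x, U x -> X x) /\
  tau (fun _ => False) /\ tau X /\
  (forall U V, tau U -> tau V -> tau (fun x => U x /\ V x)) /\
  (forall F : pset -> Prop, (forall U, F U -> tau U) ->
      tau (fun x => exists U, F U /\ U x)).

Definition def_top_space (n : nat) (X : pset) (tau : pset -> Prop) : Prop :=
  D n X /\ is_topology X tau /\
  exists m (T : pset) (B : list M -> pset),
    def_family m n T B /\
    (forall t, T t -> tau (B t)) /\
    (forall U x, tau U -> U x -> exists t, T t /\ B t x /\ forall y, B t y -> U y).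

Variables (n : nat) (X : pset) (tau : pset -> Prop).

Definition def_nbhd (x : list M) (A : pset) : Prop :=
  D n A /\ (forall y, A y -> X y) /\
  exists U, tau U /\ U x /\ forall y, U y -> A y.

Definition closed_in (C : pset) : Prop :=
  (forall y, C y -> X y) /\ tau (fun y => X y /\ ~ C y).

Definition def_curve (a b : ebar) (g : M -> list M) : Prop :=
  elt a b /\
  (forall t, in_int a b t -> X (g t)) /\
  D (1 + n) (fun z => exists t, in_int a b t /\ z = t :: g t).

Definition Conv_right (a b : ebar) (g : M -> list M) (x : list M) : Prop :=
  X x /\ forall t, in_int a b t -> forall A, def_nbhd x A ->
    exists s, in_int (Fin t) b s /\ A (g s).

Definition Conv_left (a b : ebar) (g : M -> list M) (x : list M) : Prop :=
  X x /\ forall t, in_int a b t -> forall A, def_nbhd x A ->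
    exists s, in_int a (Fin t) s /\ A (g s).

Definition def_directed (k : nat) (Om : pset) (le : list M -> list M -> Prop) : Prop :=
  D k Om /\ (exists u, Om u) /\
  D (k + k) (fun z => exists u v, Om u /\ Om v /\ le u v /\ z = u ++ v) /\
  (forall u, Om u -> le u u) /\
  (forall u v w, Om u -> Om v -> Om w -> le u v -> le v w -> le u w) /\
  (forall s : list (list M), (forall u, In u s -> Om u) ->
      exists l, Om l /\ forall u, In u s -> le l u).

Definition net_converges (Om : pset) (le : list M -> list M -> Prop)
    (g : list M -> list M) (x : list M) : Prop :=
  forall A, def_nbhd x A ->
    exists uA, Om uA /\ forall u, Om u -> le u uA -> A (g u).

Definition downward_cofinal (Om' : pset) (le' : list M -> list M -> Prop)
    (Om : pset) (le : list M -> list M -> Prop) (f : list M -> list M) : Prop :=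
  forall u, Om u -> exists v, Om' v /\ forall w, Om' w -> le' w v -> le (f w) u.

Definition cond_curves : Prop :=
  forall (a b : ebar) (g : M -> list M), def_curve a b g ->
    (exists x, Conv_right a b g x) /\ (exists x, Conv_left a b g x).

Definition cond_nets : Prop :=
  forall k (Om : pset) le (g : list M -> list M),
    def_directed k Om le -> def_map k n Om X g ->
    exists k' (Om' : pset) le' (f : list M -> list M),
      def_directed k' Om' le' /\ def_map k' k Om' Om f /\
      downward_cofinal Om' le' Om le f /\
      exists x, X x /\ net_converges Om' le' (fun w => g (f w)) x.

Definition cond_filtered : Prop :=
  forall m (T : pset) (C : list M -> pset),
    def_family m n T C ->
    (exists t, T t) ->
    (forall t, T t -> closed_in (C t) /\ exists y, C t y) ->
    (forall s t, T s -> T t -> exists u, T u /\ forall y, C u y -> C s y /\ C t y) ->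
    exists x, X x /\ forall t, T t -> C t x.

End Defs.

(* Main.v *)
(* The implication from curves to filtered families is the deep one.  Given a
   definable filtered family [C] of nonempty closed sets indexed by [T] in [M^m],
   call a set of indices bounded if some [C v] lies in all its members.  A
   definable family of bounded sets, parametrised by [M^k], has a common point:
   this is shown by induction on [k], exhausting the last parameter by compact
   pieces depending on [r] (going to infinity) and [s] (going to 0) over which
   the union stays bounded, and taking cluster points of curves for [r] and [s].
   The only obstruction, an interval of parameters without any bounded
   subinterval, is excluded by a dimension count: finitely many members always
   have a common bound [v] in [M^m], and sets without interior indexed by [M^m]
   cannot contain all finite subsets of an interval. *)
Require Import Defs.
From Stdlib Require Import List Arith Lia Classical ClassicalEpsilon
  FunctionalExtensionality PropExtensionality.
Import ListNotations.

Local Arguments st_ext {M D} _ {n A B}.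
Local Arguments st_size {M D} _ {n A x}.
Local Arguments st_compl {M D} _ {n A}.
Local Arguments st_union {M D} _ {n A B}.
Local Arguments st_prodl {M D} _ {n A}.
Local Arguments st_prodr {M D} _ {n A}.
Local Arguments st_proj {M D} _ {n A}.

(** In a locally o-minimal structure a definable subset of $M$ without interior is closed and
    discrete but may be infinite, so the finiteness and cell decomposition arguments of o-minimality
    do not apply. They are replaced by a Baire-type statement on nested definable covers of an
    interval. It implies that a union of sets without interior, indexed by such a discrete set, has
    no interior, and it gives a Fubini-type statement for subsets of $M^2$. The bad parameters are
    therefore discrete. A single bad parameter is harmless, because its own set of indices is
    bounded; only its punctured neighbourhood has to be cut away, which is the reason for the second
    scale $s$. The remaining implications all pass through filtered families. Closures of tails lead
    from them to curves and nets; a definable choice of points in the members, directed by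
    inclusion, leads back from nets. A definable base is what makes closure a definable
    operation. *)

Lemma firstn_skipn_app {A} (u v : list A) k : length u = k ->
  firstn k (u ++ v) = u /\ skipn k (u ++ v) = v.
Proof.
  intros <-. rewrite firstn_app, skipn_app, Nat.sub_diag, firstn_all, skipn_all.
  simpl. now rewrite app_nil_r.
Qed.

Lemma In_firstn {A} (a : A) n l : In a (firstn n l) -> In a l.
Proof. intros H. rewrite <- (firstn_skipn n l). apply in_or_app. now left. Qed.

Lemma In_skipn {A} (a : A) n l : In a (skipn n l) -> In a l.
Proof. intros H. rewrite <- (firstn_skipn n l). apply in_or_app. now right. Qed.

(** * Definable sets *)

Section Theory.
Variables (M : Type) (lt : M -> M -> Prop) (add : M -> M -> M) (zero : M) (opp : M -> M).
Variable D : nat -> (list M -> Prop) -> Prop.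
Hypothesis HM : DC_loc_omin_expansion lt add zero opp D.

Lemma D_structure : is_structure D.
Proof. apply HM. Qed.

Lemma D_lt : D 2 (fun x => exists a b, x = [a; b] /\ lt a b).
Proof. apply HM. Qed.

Lemma D_add : D 3 (fun x => exists a b, x = [a; b; add a b]).
Proof. apply HM. Qed.

Lemma D_pt a : D 1 (fun x => x = [a]).
Proof. apply HM. Qed.

(** Predicates are cut down to lists of length [k], so a formula may be written for arbitrary lists
    and its value at wrong lengths is irrelevant. *)
Definition definable (k : nat) (P : list M -> Prop) : Prop :=
  D k (fun x => length x = k /\ P x).

Lemma definable_of_D k A : D k A -> definable k A.
Proof.
  intros H. apply (st_ext D_structure H). intros x. split; [|tauto].
  intros Hx. split; [exact (st_size D_structure H Hx)|exact Hx].
Qed.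

Lemma D_of_definable k P A :
  definable k P -> (forall x, A x <-> length x = k /\ P x) -> D k A.
Proof. intros H HA. apply (st_ext D_structure H). intros x. now rewrite HA. Qed.

Lemma definable_ext k P Q :
  (forall x, length x = k -> (P x <-> Q x)) -> definable k P -> definable k Q.
Proof.
  intros HPQ H. apply (st_ext D_structure H). intros x. split; intros [Hx Hp]; split; auto;
    now apply HPQ.
Qed.

Lemma definable_not k P : definable k P -> definable k (fun e => ~ P e).
Proof.
  intros H. apply (st_ext D_structure (st_compl D_structure H)). intros x. tauto.
Qed.

Lemma definable_or k P Q :
  definable k P -> definable k Q -> definable k (fun e => P e \/ Q e).
Proof.
  intros H1 H2. apply (st_ext D_structure (st_union D_structure H1 H2)). intros x. tauto.
Qed.

Lemma definable_and k P Q :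
  definable k P -> definable k Q -> definable k (fun e => P e /\ Q e).
Proof.
  intros H1 H2.
  apply definable_ext with (fun e => ~ (~ P e \/ ~ Q e)); [intros; tauto|].
  apply definable_not, definable_or; now apply definable_not.
Qed.

Lemma definable_imp k P Q :
  definable k P -> definable k Q -> definable k (fun e => P e -> Q e).
Proof.
  intros H1 H2.
  apply definable_ext with (fun e => ~ P e \/ Q e); [intros; tauto|].
  apply definable_or; [now apply definable_not|trivial].
Qed.

Lemma definable_const k (P : Prop) : definable k (fun _ => P).
Proof.
  destruct (classic P) as [HP|HP].
  - apply (st_ext D_structure (st_full D_structure k)). intros; tauto.
  - apply (st_ext D_structure (st_compl D_structure (st_full D_structure k))). intros; tauto.
Qed.

(** Variable binding is encoded by position: in the premise, [firstn k e] holds the old variables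
    and [skipn k e] the bound tuple, so the premise is again a formula in one list. *)
Lemma definable_exists_vec k m (P : list M -> list M -> Prop) :
  definable (k + m) (fun e => P (firstn k e) (skipn k e)) ->
  definable k (fun e => exists v, length v = m /\ P e v).
Proof.
  assert (HE : forall m (A : list M -> Prop), D (k + m) A ->
            D k (fun x => exists v, length v = m /\ A (x ++ v))).
  { clear m P. intros m. induction m as [|m IH]; intros A HA.
    - rewrite Nat.add_0_r in HA. apply (st_ext D_structure HA). intros x. split.
      + intros Hx. exists []. now rewrite app_nil_r.
      + intros [[|] [Hl Hx]]; [|discriminate]. now rewrite app_nil_r in Hx.
    - replace (k + S m) with (S (k + m)) in HA by lia.
      apply (st_ext D_structure (IH _ (st_proj D_structure HA))). intros x. split.
      + intros (v & Hv & a & Ha). exists (v ++ [a]).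
        rewrite length_app, app_assoc. simpl. split; [lia|trivial].
      + intros (v & Hv & Ha). destruct (exists_last (l := v)) as (w & a & ->).
        { now intros ->. }
        rewrite length_app in Hv. simpl in Hv. exists w. split; [lia|].
        exists a. now rewrite <- app_assoc. }
  intros H. apply (st_ext D_structure (HE m _ H)). intros x. split.
  - intros (v & Hv & Hl & Hp). rewrite length_app in Hl.
    assert (Hx : length x = k) by lia. split; [trivial|]. exists v. split; [trivial|].
    destruct (firstn_skipn_app x v k Hx) as [E1 E2]. now rewrite E1, E2 in Hp.
  - intros (Hx & v & Hv & Hp). exists v. split; [trivial|].
    rewrite length_app. split; [lia|].
    now destruct (firstn_skipn_app x v k Hx) as [-> ->].
Qed.

Lemma definable_forall_vec k m (P : list M -> list M -> Prop) :
  definable (k + m) (fun e => P (firstn k e) (skipn k e)) ->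
  definable k (fun e => forall v, length v = m -> P e v).
Proof.
  intros H. apply definable_ext with (fun e => ~ exists v, length v = m /\ ~ P e v).
  - intros e _. split.
    + intros Hn v Hv. apply NNPP. intros Hp. apply Hn. eauto.
    + intros Hp (v & Hv & Hn). auto.
  - apply definable_not, (definable_exists_vec k m (fun e v => ~ P e v)).
    now apply definable_not.
Qed.

Lemma definable_exists k (P : list M -> M -> Prop) :
  definable (k + 1) (fun e => P (firstn k e) (nth k e zero)) ->
  definable k (fun e => exists a, P e a).
Proof.
  intros H.
  apply definable_ext with (fun e => exists v, length v = 1 /\ P e (nth 0 v zero)).
  - intros e _. split.
    + intros (v & _ & Hp). eauto.
    + intros (a & Hp). now exists [a].
  - apply (definable_exists_vec k 1 (fun e v => P e (nth 0 v zero))).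
    revert H. apply definable_ext. intros x Hx.
    rewrite nth_skipn, Nat.add_0_r. tauto.
Qed.

Lemma definable_forall k (P : list M -> M -> Prop) :
  definable (k + 1) (fun e => P (firstn k e) (nth k e zero)) ->
  definable k (fun e => forall a, P e a).
Proof.
  intros H. apply definable_ext with (fun e => ~ exists a, ~ P e a).
  - intros e _. split.
    + intros Hn a. apply NNPP. intros Hp. apply Hn. eauto.
    + intros Hp (v & Hn). auto.
  - apply definable_not, (definable_exists k (fun e v => ~ P e v)).
    now apply definable_not.
Qed.

Definition coord (e : list M) (c : nat + M) : M :=
  match c with inl i => nth i e zero | inr a => a end.

(** Each output entry is an input coordinate or a parameter; only such terms are substituted into
    formulas. Sums are not among them, so later formulas name a sum by a bound variable, as in
    [forall w, w = add b s -> ...]. *)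
Definition tuple_map (k m : nat) (f : list M -> list M) : Prop :=
  exists cs, length cs = m /\ (forall i, In (inl i) cs -> i < k) /\
    forall e, length e = k -> f e = map (coord e) cs.

(** Two coordinates are compared by [st_diag]. A coordinate is fixed to a parameter by padding the
    definable point [[a]] with free coordinates on both sides. *)
Lemma definable_coord_eq k i c :
  i < k -> (forall j, c = inl j -> j < k) ->
  definable k (fun e => nth i e zero = coord e c).
Proof.
  intros Hi Hc. destruct c as [j|a]; simpl.
  - specialize (Hc j eq_refl). apply (D_of_definable k (fun e => nth_error e i = nth_error e j)).
    + exact (st_ext D_structure (st_diag D_structure Hi Hc) (fun x => iff_refl _)).
    + intros x. split; intros [Hx H]; split; auto.
      * rewrite (nth_error_nth' x zero), (nth_error_nth' x zero), H; trivial; lia.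
      * rewrite (nth_error_nth' x zero), (nth_error_nth' x zero) in H by lia. congruence.
  - assert (HL : forall i, D (i + 1) (fun x => length x = i + 1 /\ nth i x zero = a)).
    { clear i Hi. intros i. induction i as [|i IH].
      - apply (st_ext D_structure (D_pt a)). intros x. split.
        + now intros ->.
        + intros [Hx Ha]. destruct x as [|b [|]]; try discriminate. simpl in Ha. congruence.
      - apply (st_ext D_structure (st_prodl D_structure IH)). intros x. split.
        + intros (b & y & -> & Hy & Ha). split; simpl; [lia|trivial].
        + intros [Hx Ha]. destruct x as [|b y]; [discriminate|].
          exists b, y. split; [trivial|]. split; [simpl in Hx; lia|trivial]. }
    assert (HR : forall j, D (i + 1 + j) (fun x => length x = i + 1 + j /\ nth i x zero = a)).
    { intros j. induction j as [|j IH].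
      - rewrite Nat.add_0_r. apply HL.
      - rewrite Nat.add_succ_r. apply (st_ext D_structure (st_prodr D_structure IH)). intros x. split.
        + intros (y & b & -> & Hy & Ha). rewrite length_app, app_nth1 by lia.
          split; simpl; [lia|trivial].
        + intros [Hx Ha]. destruct (exists_last (l := x)) as (y & b & ->).
          { now intros ->. }
          rewrite length_app in Hx. simpl in Hx. exists y, b. split; [trivial|].
          rewrite app_nth1 in Ha by lia. split; [lia|trivial]. }
    replace k with (i + 1 + (k - (i + 1))) by lia. apply HR.
Qed.

(** A structure has no substitution axiom. [P (f e)] becomes the existence of [v] with [P v] and
    [v = f e]: a projection of a cylinder cut by finitely many coordinate equations. *)
Lemma definable_subst k m f P :
  definable m P -> tuple_map k m f -> definable k (fun e => P (f e)).
Proof.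
  intros HP (cs & Hl & Hcs & Hf).
  assert (HP' : definable (k + m) (fun z => P (skipn k z))).
  { clear - HM HP. induction k as [|k IH].
    - revert HP. apply definable_ext. intros x _. reflexivity.
    - apply (st_ext D_structure (st_prodl D_structure IH)). intros x. split.
      + intros (b & y & -> & Hy & Ha). split; simpl; [lia|trivial].
      + intros [Hx Ha]. destruct x as [|b y]; [discriminate|].
        exists b, y. split; [trivial|]. split; [simpl in Hx; lia|trivial]. }
  assert (HC : forall m', m' <= m -> definable (k + m) (fun z => forall j, j < m' ->
             nth (k + j) z zero = coord z (nth j cs (inr zero)))).
  { intros m' Hm'. induction m' as [|m' IH].
    - apply definable_ext with (fun _ => True); [|apply definable_const].
      intros; split; [intros; lia|trivial].
    - apply definable_ext with (fun z =>
        (forall j, j < m' -> nth (k + j) z zero = coord z (nth j cs (inr zero))) /\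
        nth (k + m') z zero = coord z (nth m' cs (inr zero))).
      + intros x _. split.
        * intros [H1 H2] j Hj. destruct (Nat.eq_dec j m') as [->|Hn]; [trivial|].
          apply H1. lia.
        * intros H. split; [intros j Hj; apply H; lia|apply H; lia].
      + apply definable_and; [apply IH; lia|].
        apply definable_coord_eq; [lia|]. intros j Hj.
        assert (In (inl j) cs); [|apply Nat.lt_lt_add_r; auto].
        rewrite <- Hj. apply nth_In. lia. }
  assert (HN : forall e v c, length e = k -> In c cs -> coord (e ++ v) c = coord e c).
  { intros e v [i|a] He Hi; simpl; [|trivial]. apply app_nth1. rewrite He. auto. }
  apply definable_ext with (fun e => exists v, length v = m /\
    (P v /\ forall j, j < m -> nth (k + j) (e ++ v) zero = coord (e ++ v) (nth j cs (inr zero)))).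
  - intros e He. rewrite Hf by trivial. split.
    + intros (v & Hv & Hp & Hj). replace (map (coord e) cs) with v; [trivial|].
      apply nth_ext with zero (coord e (inr zero)).
      * rewrite length_map. lia.
      * intros j Hjl. rewrite map_nth, <- (HN e v), <- Hj; trivial; [|lia|apply nth_In; lia].
        rewrite app_nth2 by lia. f_equal. lia.
    + intros Hp. exists (map (coord e) cs). rewrite length_map. split; [trivial|].
      split; [trivial|]. intros j Hj. rewrite app_nth2 by lia.
      replace (k + j - length e) with j by lia.
      rewrite HN by (trivial; apply nth_In; lia).
      change zero with (coord e (inr zero)) at 1. apply map_nth.
  - apply (definable_exists_vec k m (fun e v => P v /\ forall j, j < m ->
       nth (k + j) (e ++ v) zero = coord (e ++ v) (nth j cs (inr zero)))).
    apply definable_and; [trivial|].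
    apply definable_ext with (2 := HC m (le_n m)). intros x _.
    now rewrite firstn_skipn.
Qed.

Lemma tuple_map_eq k m m' f : tuple_map k m f -> m = m' -> tuple_map k m' f.
Proof. now intros H <-. Qed.

Lemma tuple_map_id k : tuple_map k k (fun e => e).
Proof.
  exists (map inl (seq 0 k)). split; [rewrite length_map, length_seq; trivial|]. split.
  - intros i Hi. apply in_map_iff in Hi. destruct Hi as (j & Hj & Hi).
    apply in_seq in Hi. injection Hj. lia.
  - intros e He. rewrite map_map. simpl. apply nth_ext with zero (nth 0 e zero).
    + now rewrite length_map, length_seq.
    + intros j Hj. rewrite (map_nth (fun i => nth i e zero)), seq_nth; [trivial|lia].
Qed.

Lemma tuple_map_const k c : tuple_map k (length c) (fun _ => c).
Proof.
  exists (map inr c). split; [apply length_map|]. split.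
  - intros i Hi. apply in_map_iff in Hi. destruct Hi as (j & Hj & _). discriminate.
  - intros e _. rewrite map_map. simpl. now rewrite map_id.
Qed.

Lemma tuple_map_app k m1 m2 f g :
  tuple_map k m1 f -> tuple_map k m2 g -> tuple_map k (m1 + m2) (fun e => f e ++ g e).
Proof.
  intros (cs & Hl & Hc & Hf) (cs' & Hl' & Hc' & Hg). exists (cs ++ cs').
  rewrite length_app. split; [lia|]. split.
  - intros i Hi. apply in_app_iff in Hi. destruct Hi; auto.
  - intros e He. rewrite map_app, Hf, Hg; trivial.
Qed.

Lemma tuple_map_cons k m (f : list M -> M) g :
  tuple_map k 1 (fun e => [f e]) -> tuple_map k m g ->
  tuple_map k (S m) (fun e => f e :: g e).
Proof. exact (@tuple_map_app k 1 m (fun e => [f e]) g). Qed.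

Lemma tuple_map_firstn k m j f :
  tuple_map k m f -> j <= m -> tuple_map k j (fun e => firstn j (f e)).
Proof.
  intros (cs & Hl & Hc & Hf) Hj. exists (firstn j cs).
  rewrite length_firstn. split; [lia|]. split.
  - intros i Hi. apply In_firstn in Hi. auto.
  - intros e He. rewrite Hf by trivial. apply firstn_map.
Qed.

Lemma tuple_map_skipn k m j f :
  tuple_map k m f -> tuple_map k (m - j) (fun e => skipn j (f e)).
Proof.
  intros (cs & Hl & Hc & Hf). exists (skipn j cs).
  rewrite length_skipn. split; [lia|]. split.
  - intros i Hi. apply In_skipn in Hi. auto.
  - intros e He. rewrite Hf by trivial. apply skipn_map.
Qed.

Lemma tuple_map_nth k m j f :
  tuple_map k m f -> j < m -> tuple_map k 1 (fun e => [nth j (f e) zero]).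
Proof.
  intros (cs & Hl & Hc & Hf) Hj. exists [nth j cs (inr zero)].
  split; [trivial|]. split.
  - intros i [Hi|[]]. apply Hc. rewrite <- Hi. apply nth_In. lia.
  - intros e He. rewrite Hf by trivial. simpl. f_equal.
    change zero with (coord e (inr zero)) at 1. apply map_nth.
Qed.

Lemma definable_rel k m A f : D m A -> tuple_map k m f -> definable k (fun e => A (f e)).
Proof. intros H. apply definable_subst. now apply definable_of_D. Qed.

Lemma definable_lt k (f g : list M -> M) :
  tuple_map k 1 (fun e => [f e]) -> tuple_map k 1 (fun e => [g e]) ->
  definable k (fun e => lt (f e) (g e)).
Proof.
  intros Hf Hg.
  pose proof (definable_rel _ _ _ _ D_lt (tuple_map_app k 1 1 _ _ Hf Hg)) as H.
  revert H. apply definable_ext. intros x _. simpl. split.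
  - intros (a & b & He & Hl). injection He as -> ->. trivial.
  - eauto.
Qed.

Lemma definable_eq_add k (f g h : list M -> M) :
  tuple_map k 1 (fun e => [f e]) -> tuple_map k 1 (fun e => [g e]) ->
  tuple_map k 1 (fun e => [h e]) ->
  definable k (fun e => h e = add (f e) (g e)).
Proof.
  intros Hf Hg Hh.
  pose proof (definable_rel _ _ _ _ D_add
    (tuple_map_app k 2 1 _ _ (tuple_map_app k 1 1 _ _ Hf Hg) Hh)) as H.
  revert H. apply definable_ext. intros x _. simpl. split.
  - intros (a & b & He). injection He as -> -> ->. trivial.
  - intros ->. eauto.
Qed.

Lemma definable_eq k (f g : list M -> M) :
  tuple_map k 1 (fun e => [f e]) -> tuple_map k 1 (fun e => [g e]) ->
  definable k (fun e => f e = g e).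
Proof.
  intros Hf Hg. apply (definable_ext k (fun e => nth 0 [f e; g e] zero = nth 1 [f e; g e] zero)).
  - intros; simpl; tauto.
  - apply (definable_subst k 2 (fun e => [f e; g e])
      (fun z => nth 0 z zero = coord z (inl 1))).
    + apply definable_coord_eq; [lia|]. intros j Hj. injection Hj. lia.
    + exact (tuple_map_app k 1 1 _ _ Hf Hg).
Qed.

Lemma tuple_map_length k m f e : tuple_map k m f -> length e = k -> length (f e) = m.
Proof. intros (cs & <- & _ & Hf) He. now rewrite Hf, length_map. Qed.

Lemma definable_eq_vec k m f g :
  tuple_map k m f -> tuple_map k m g -> definable k (fun e => f e = g e).
Proof.
  intros Hf Hg.
  assert (HI : forall j, j <= m ->
    definable k (fun e => forall i, i < j -> nth i (f e) zero = nth i (g e) zero)).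
  { induction j as [|j IH]; intros Hj.
    - apply definable_ext with (fun _ => True); [|apply definable_const].
      intros; split; [intros; lia|trivial].
    - apply definable_ext with (fun e =>
        (forall i, i < j -> nth i (f e) zero = nth i (g e) zero) /\
        nth j (f e) zero = nth j (g e) zero).
      + intros e _. split.
        * intros [H1 H2] i Hi. destruct (Nat.eq_dec i j) as [->|Hn]; [trivial|].
          apply H1. lia.
        * intros H. split; intros; apply H; lia.
      + apply definable_and; [apply IH; lia|].
        apply definable_eq; eapply tuple_map_nth; eauto. }
  apply definable_ext with (2 := HI m (le_n m)). intros e He.
  pose proof (tuple_map_length _ _ _ _ Hf He). pose proof (tuple_map_length _ _ _ _ Hg He).
  split.
  - intros Hn. apply nth_ext with zero zero; [lia|]. intros i Hi. apply Hn. lia.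
  - now intros ->.
Qed.

(** Definability of curried predicates: [M] marks an argument that is a single element, [V] one that
    is a tuple. *)
Definition defM (S : M -> Prop) : Prop := definable 1 (fun e => S (nth 0 e zero)).
Definition defMM (A : M -> M -> Prop) : Prop :=
  definable 2 (fun e => A (nth 0 e zero) (nth 1 e zero)).
Definition defVM (m : nat) (F : list M -> M -> Prop) : Prop :=
  definable (m + 1) (fun e => F (firstn m e) (nth m e zero)).
Definition defVV (m n : nat) (R : list M -> list M -> Prop) : Prop :=
  definable (m + n) (fun e => R (firstn m e) (skipn m e)).

Lemma definable_appM k S (f : list M -> M) :
  defM S -> tuple_map k 1 (fun e => [f e]) -> definable k (fun e => S (f e)).
Proof. intros H Hf. exact (definable_subst _ _ _ _ H Hf). Qed.

Lemma definable_appMM k A (f g : list M -> M) :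
  defMM A -> tuple_map k 1 (fun e => [f e]) -> tuple_map k 1 (fun e => [g e]) ->
  definable k (fun e => A (f e) (g e)).
Proof.
  intros H Hf Hg. exact (definable_subst _ _ _ _ H (tuple_map_app k 1 1 _ _ Hf Hg)).
Qed.

Lemma definable_appVM k m F f (g : list M -> M) :
  defVM m F -> tuple_map k m f -> tuple_map k 1 (fun e => [g e]) ->
  definable k (fun e => F (f e) (g e)).
Proof.
  intros H Hf Hg.
  apply definable_ext with (2 := definable_subst _ _ _ _ H (tuple_map_app k m 1 _ _ Hf Hg)).
  intros e He. pose proof (tuple_map_length _ _ _ _ Hf He) as Hl.
  destruct (firstn_skipn_app (f e) [g e] m Hl) as [-> _].
  now rewrite app_nth2, Hl, Nat.sub_diag by lia.
Qed.

Lemma definable_appVV k m n R f g :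
  defVV m n R -> tuple_map k m f -> tuple_map k n g -> definable k (fun e => R (f e) (g e)).
Proof.
  intros H Hf Hg.
  apply definable_ext with (2 := definable_subst _ _ _ _ H (tuple_map_app k m n _ _ Hf Hg)).
  intros e He. pose proof (tuple_map_length _ _ _ _ Hf He) as Hl.
  now destruct (firstn_skipn_app (f e) (g e) m Hl) as [-> ->].
Qed.

Lemma defVV_of_family m n T B :
  def_family D m n T B -> (forall t x, T t -> B t x -> length x = n) ->
  defVV m n (fun t x => T t /\ B t x).
Proof.
  intros [HT HB] Hx. apply definable_ext with (2 := definable_of_D _ _ HB).
  intros z Hz. split.
  - intros (t & x & -> & Ht & Hb). pose proof (st_size D_structure HT Ht) as Hl.
    now destruct (firstn_skipn_app t x m Hl) as [-> ->].
  - intros [Ht Hb]. exists (firstn m z), (skipn m z). now rewrite firstn_skipn.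
Qed.

(** * Automation for definability *)

Ltac len := rewrite ?length_app; simpl length; lia.

Ltac tmap_rec :=
  lazymatch goal with
  | |- tuple_map _ _ (fun e => e) => apply tuple_map_id
  | |- tuple_map _ _ (fun _ => ?c) => apply (tuple_map_const _ c)
  | |- tuple_map _ _ (fun e => firstn ?j (@?f e)) =>
      eapply (tuple_map_firstn _ _ j f); [tmap_rec|len]
  | |- tuple_map _ _ (fun e => skipn ?j (@?f e)) => eapply (tuple_map_skipn _ _ j f); tmap_rec
  | |- tuple_map _ _ (fun e => [nth ?j (@?f e) _]) =>
      eapply (tuple_map_nth _ _ j f); [tmap_rec|len]
  | |- tuple_map _ _ (fun e => @?f e ++ @?g e) => eapply (tuple_map_app _ _ _ f g); tmap_rec
  | |- tuple_map _ _ (fun e => @?f e :: @?g e) => eapply (tuple_map_cons _ _ f g); tmap_rec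
  end.

Ltac tmap := cbv beta; eapply tuple_map_eq; [tmap_rec|len].

(** Follows the syntax of the formula down to atoms, which are closed by [lt], [add], equality or a
    definability hypothesis in the context; a goal that fits no case is left open. Quantifiers over
    tuples must be guarded by a length, whence guards such as [length x = n] in the definitions
    below. *)
Ltac defn :=
  cbv beta;
  lazymatch goal with
  | |- definable _ (fun _ => _) => idtac
  | |- definable ?k ?P => change (definable k (fun e => P e))
  end;
  first
  [ lazymatch goal with |- definable _ (fun _ => ?P) => apply (definable_const _ P) end
  | lazymatch goal with
    | |- definable _ (fun e => exists v : list M, _) => apply definable_exists_vec; defn
    | |- definable _ (fun e => forall v : list M, _) => apply definable_forall_vec; defn
    | |- definable _ (fun e => exists v : M, _) => apply definable_exists; defn
    | |- definable _ (fun e => forall v : M, _) => apply definable_forall; defn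
    | |- definable _ (fun e => _ /\ _) => apply definable_and; defn
    | |- definable _ (fun e => _ \/ _) => apply definable_or; defn
    | |- definable _ (fun e => ~ _) => apply definable_not; defn
    | |- definable _ (fun e => _ -> _) => apply definable_imp; defn
    end
  | match goal with
    | |- definable _ (fun e => lt _ _) => apply definable_lt; tmap
    | |- definable _ (fun e => _ = add _ _) => apply definable_eq_add; tmap
    | |- definable _ (fun e => @eq M _ _) => apply definable_eq; tmap
    | H : D ?m ?A |- definable ?k (fun e => ?A (@?f e)) => apply (definable_rel k m A f H); tmap
    | H : definable ?m ?A |- definable ?k (fun e => ?A (@?f e)) =>
        apply (definable_subst k m f A H); tmap
    | H : defM ?A |- definable ?k (fun e => ?A (@?f e)) =>
        apply (definable_appM k A f H); tmap
    | H : defMM ?A |- definable ?k (fun e => ?A (@?f e) (@?g e)) =>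
        apply (definable_appMM k A f g H); tmap
    | H : defVM ?m ?A |- definable ?k (fun e => ?A (@?f e) (@?g e)) =>
        apply (definable_appVM k m A f g H); tmap
    | H : defVV ?m ?n ?A |- definable ?k (fun e => ?A (@?f e) (@?g e)) =>
        apply (definable_appVV k m n A f g H); tmap
    end
  | idtac ].

(** * Definable subsets of the line *)

Lemma lt_irrefl x : ~ lt x x.
Proof. apply HM. Qed.
Lemma lt_trans x y z : lt x y -> lt y z -> lt x z.
Proof. apply HM. Qed.
Lemma lt_total x y : lt x y \/ x = y \/ lt y x.
Proof. apply HM. Qed.
Lemma lt_dense x y : lt x y -> exists z, lt x z /\ lt z y.
Proof. apply HM. Qed.
Lemma lt_nomin x : exists y, lt y x.
Proof. apply HM. Qed.
Lemma lt_nomax x : exists y, lt x y.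
Proof. apply HM. Qed.

Ltac order_saturate :=
  repeat match goal with
  | H1 : lt ?a ?b, H2 : lt ?b ?c |- _ =>
      lazymatch goal with
      | H : lt a c |- _ => fail
      | _ => pose proof (lt_trans _ _ _ H1 H2)
      end
  | H1 : lt ?a ?b, H2 : ?b = ?c |- _ =>
      lazymatch goal with
      | H : lt a c |- _ => fail
      | _ => pose proof (eq_ind b (lt a) H1 c H2)
      end
  | H1 : lt ?b ?a, H2 : ?b = ?c |- _ =>
      lazymatch goal with
      | H : lt c a |- _ => fail
      | _ => assert (lt c a) by exact (eq_ind b (fun z => lt z a) H1 c H2)
      end
  | H1 : lt ?a ?b, H2 : ?c = ?b |- _ =>
      lazymatch goal with
      | H : lt a c |- _ => fail
      | _ => pose proof (eq_ind_r (lt a) H1 H2)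
      end
  | H1 : lt ?b ?a, H2 : ?c = ?b |- _ =>
      lazymatch goal with
      | H : lt c a |- _ => fail
      | _ => assert (lt c a) by exact (eq_ind_r (fun z => lt z a) H1 H2)
      end
  end.

Ltac order_split :=
  match goal with
  | H : ~ lt ?a ?b |- _ =>
      let H' := fresh in
      destruct (lt_total a b) as [H'|[H'|H']]; [destruct (H H')|clear H|clear H]
  end.

Ltac order_close :=
  order_saturate;
  match goal with
  | H : lt ?a ?a |- _ => destruct (lt_irrefl a H)
  | |- ?a = ?a => reflexivity
  end.

Ltac order :=
  intros; repeat order_split;
  lazymatch goal with
  | |- ~ _ => intro
  | |- lt ?a ?b => destruct (lt_total a b) as [?|[?|?]]; [assumption| |]
  | |- @eq M ?a ?b => destruct (lt_total a b) as [?|[?|?]]; [|assumption|]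
  | |- _ => exfalso
  end; order_close.

(** * Ordered group arithmetic, suprema and infima *)

Lemma add_assoc x y z : add x (add y z) = add (add x y) z.
Proof. apply HM. Qed.
Lemma add_comm x y : add x y = add y x.
Proof. apply HM. Qed.
Lemma add_zero x : add x zero = x.
Proof. apply HM. Qed.
Lemma add_opp x : add x (opp x) = zero.
Proof. apply HM. Qed.
Lemma lt_add_r x y z : lt x y -> lt (add x z) (add y z).
Proof. apply HM. Qed.

Lemma lt_add_l x y z : lt x y -> lt (add z x) (add z y).
Proof. rewrite (add_comm z x), (add_comm z y). apply lt_add_r. Qed.

Lemma add_cancel x y : add (add x y) (opp y) = x.
Proof. now rewrite <- add_assoc, add_opp, add_zero. Qed.

Lemma sub_cancel x y : add (add x (opp y)) y = x.
Proof. now rewrite <- add_assoc, (add_comm (opp y)), add_opp, add_zero. Qed.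

Lemma lt_add_r_inv x y z : lt (add x z) (add y z) -> lt x y.
Proof.
  intros H. apply (lt_add_r _ _ (opp z)) in H. now rewrite !add_cancel in H.
Qed.

Lemma lt_add_pos x s : lt zero s -> lt x (add x s).
Proof. intros H. apply (lt_add_l _ _ x) in H. now rewrite add_zero in H. Qed.

Lemma lt_add_add x y z w : lt x y -> ~ lt w z -> lt (add x z) (add y w).
Proof.
  intros H1 H2. destruct (lt_total z w) as [H|[->|H]]; [| |contradiction].
  - apply lt_trans with (add y z); [now apply lt_add_r|now apply lt_add_l].
  - now apply lt_add_r.
Qed.

(** Density replaces division by 2: for [x] strictly between 0 and [s], any positive [e] below both
    [x] and [s - x] works. *)
Lemma small_half s : lt zero s -> exists e, lt zero e /\ lt (add e e) s.
Proof.
  intros Hs. destruct (lt_dense _ _ Hs) as (x & Hx & Hxs).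
  assert (Hy : lt zero (add s (opp x))).
  { apply (lt_add_r_inv _ _ x). rewrite sub_cancel, add_comm, add_zero. trivial. }
  assert (Hm : exists m, lt zero m /\ ~ lt x m /\ ~ lt (add s (opp x)) m).
  { destruct (lt_total x (add s (opp x))) as [H|[H|H]].
    - exists x. repeat split; trivial; order.
    - exists x. repeat split; trivial; order.
    - exists (add s (opp x)). repeat split; trivial; order. }
  destruct Hm as (m & Hm0 & Hm1 & Hm2). destruct (lt_dense _ _ Hm0) as (e & He0 & He).
  exists e. split; [trivial|].
  rewrite <- (sub_cancel s x). apply lt_add_add; order.
Qed.

Lemma sup_exists S : defM S -> (exists y, S y) -> (exists b, forall y, S y -> ~ lt b y) ->
  exists s, (forall y, S y -> ~ lt s y) /\ (forall u, lt u s -> exists y, S y /\ lt u y).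
Proof.
  intros HS (y0 & Hy0) (b & Hb).
  destruct HM as (_ & _ & _ & _ & _ & _ & Hc).
  destruct (Hc _ HS) as [(s & Hs1 & Hs2) _]. simpl in Hs1, Hs2.
  destruct s as [|s|].
  - destruct (Hs1 y0); [auto|now simpl in *|discriminate].
  - exists s. split.
    + intros y Hy Hl. destruct (Hs1 y) as [H|H]; [auto|simpl in H; order|].
      injection H as ->. order.
    + intros u Hu. apply NNPP. intros Hn. destruct (Hs2 (Fin u)) as [H|H].
      * intros y [_ Hy]. destruct (lt_total y u) as [?|[->|?]]; [now left|now right|].
        destruct Hn. eauto.
      * simpl in H. order.
      * injection H as ->. order.
  - destruct (Hs2 (Fin b)) as [H|H]; [|now simpl in H|discriminate].
    intros y [_ Hy]. destruct (lt_total y b) as [?|[->|?]]; [now left|now right|].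
    destruct (Hb y); trivial.
Qed.

Lemma inf_exists S : defM S -> (exists y, S y) -> (exists b, forall y, S y -> ~ lt y b) ->
  exists s, (forall y, S y -> ~ lt y s) /\ (forall u, lt s u -> exists y, S y /\ lt y u).
Proof.
  intros HS (y0 & Hy0) (b & Hb).
  destruct (sup_exists (fun x => forall y, S y -> ~ lt y x)) as (s & Hs1 & Hs2).
  - unfold defM. defn.
  - eauto.
  - exists y0. intros y Hy. now apply Hy.
  - exists s. split.
    + intros y Hy Hl. destruct (Hs2 _ Hl) as (x & Hx & Hxy). now apply (Hx y).
    + intros u Hu. apply NNPP. intros Hn. apply (Hs1 u); [|trivial].
      intros y Hy Hl. apply Hn. eauto.
Qed.

(** [ev A] stands for [A] holding close to [p] on one side; keeping it abstract serves both sides.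
    The sets decided by [ev] form a Boolean algebra containing rays and points, hence all finite
    unions of points and intervals, and local o-minimality gives [S] this form near [p]. *)
Lemma germ_dichotomy (ev : (M -> Prop) -> Prop) p S :
  (forall A B : M -> Prop, ev A -> ev B -> ev (fun t => A t /\ B t)) ->
  (forall A B : M -> Prop, (forall t, A t -> B t) -> ev A -> ev B) ->
  (forall q, (ev (fun t => lt t q) /\ ~ lt q p) \/ (ev (fun t => lt q t) /\ ~ lt p q)) ->
  defM S -> ev S \/ ev (fun t => ~ S t).
Proof.
  intros Hand Hmono Hcut HS.
  pose (good := fun A : M -> Prop => ev A \/ ev (fun t => ~ A t)).
  assert (Htop : ev (fun _ => True)).
  { destruct (Hcut p) as [[H _]|[H _]]; apply Hmono with (2 := H); auto. }
  assert (Hor : forall A B : M -> Prop, good A -> good B -> good (fun t => A t \/ B t)).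
  { intros A B [HA|HA]; [left; apply Hmono with (2 := HA); auto|].
    intros [HB|HB]; [left; apply Hmono with (2 := HB); auto|].
    right. apply Hmono with (2 := Hand _ _ HA HB). tauto. }
  assert (Hext : forall A B : M -> Prop, (forall t, A t <-> B t) -> good A -> good B).
  { intros A B HAB [H|H]; [left|right]; apply Hmono with (2 := H); intros t;
      rewrite HAB; auto. }
  assert (Hnot : forall A : M -> Prop, good A -> good (fun t => ~ A t)).
  { intros A [H|H]; [right|left; trivial]. apply Hmono with (2 := H). tauto. }
  assert (Htrue : good (fun _ => True)) by (left; trivial).
  assert (Hfalse : good (fun _ => False)) by (right; apply Hmono with (2 := Htop); auto).
  assert (Hboth : forall A B : M -> Prop, good A -> good B -> good (fun t => A t /\ B t)).
  { intros A B HA HB. apply Hext with (fun t => ~ (~ A t \/ ~ B t)); [intros; tauto|auto]. }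
  assert (Hlt : forall q, good (fun t => lt t q)).
  { intros q. destruct (Hcut q) as [[H _]|[H _]]; [now left|right].
    apply Hmono with (2 := H). order. }
  assert (Hgt : forall q, good (fun t => lt q t)).
  { intros q. destruct (Hcut q) as [[H _]|[H _]]; [right|now left].
    apply Hmono with (2 := H). order. }
  assert (Heq : forall q, good (fun t => q = t)).
  { intros q. right. destruct (Hcut q) as [[H _]|[H _]]; apply Hmono with (2 := H); order. }
  assert (Hint : forall l u, good (fun t => Defs.in_int lt l u t)).
  { intros l u. apply Hboth; [destruct l|destruct u]; simpl; auto. }
  destruct HM as (_ & _ & _ & _ & _ & Hl & _).
  destruct (Hl _ p HS) as (l & u & [Hp1 Hp2] & ps & ivs & HZ).
  assert (HG : good (fun t => S t /\ Defs.in_int lt l u t)).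
  { apply Hext with (fun t => In t ps \/ exists q, In q ivs /\ Defs.in_int lt (fst q) (snd q) t).
    - intros t. rewrite <- HZ. simpl. tauto.
    - apply Hor; clear HZ.
      + induction ps as [|q ps IH]; simpl; auto.
      + induction ivs as [|q ivs IH].
        * apply Hext with (2 := Hfalse). intros t. simpl. split; [tauto|].
          now intros (q & [] & _).
        * apply Hext with (2 := Hor _ _ (Hint (fst q) (snd q)) IH). intros t. simpl. split.
          -- intros [H|(q' & H1 & H2)]; [exists q|exists q']; auto.
          -- intros (q' & [->|H1] & H2); [now left|right; eauto]. }
  (* Since [l < p < u], the second halves of the alternatives in [Hcut] exclude the wrong side. *)
  assert (HI : ev (fun t => Defs.in_int lt l u t)).
  { apply Hand; [destruct l as [|l|]|destruct u as [|u|]]; simpl in *; trivial; try tauto.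
    - destruct (Hcut l) as [[_ H]|[H _]]; [contradiction|trivial].
    - destruct (Hcut u) as [[H _]|[_ H]]; [trivial|contradiction]. }
  destruct HG as [H|H]; [left|right]; apply Hmono with (2 := Hand _ _ HI H); tauto.
Qed.

Lemma right_germ S p : defM S -> exists d, lt p d /\
  ((forall t, lt p t -> lt t d -> S t) \/ (forall t, lt p t -> lt t d -> ~ S t)).
Proof.
  intros HS.
  destruct (germ_dichotomy (fun A => exists d, lt p d /\ forall t, lt p t -> lt t d -> A t) p S)
    as [(d & Hd & H)|(d & Hd & H)]; eauto.
  - intros A B (d1 & H1 & HA) (d2 & H2 & HB).
    destruct (lt_total d1 d2) as [?|[?|?]]; [exists d1|exists d1|exists d2];
      (split; [trivial|]); intros; (split; [apply HA|apply HB]); order.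
  - intros A B HAB (d & Hd & H). exists d. auto.
  - intros q. destruct (lt_total p q) as [H|H].
    + left. split; [|order]. exists q. auto.
    + right. split; [|destruct H; order]. destruct (lt_nomax p) as (d & Hd).
      exists d. split; [trivial|]. destruct H; order.
Qed.

Lemma left_germ S p : defM S -> exists c, lt c p /\
  ((forall t, lt c t -> lt t p -> S t) \/ (forall t, lt c t -> lt t p -> ~ S t)).
Proof.
  intros HS.
  destruct (germ_dichotomy (fun A => exists c, lt c p /\ forall t, lt c t -> lt t p -> A t) p S)
    as [(d & Hd & H)|(d & Hd & H)]; eauto.
  - intros A B (d1 & H1 & HA) (d2 & H2 & HB).
    destruct (lt_total d1 d2) as [?|[?|?]]; [exists d2|exists d1|exists d1];
      (split; [trivial|]); intros; (split; [apply HA|apply HB]); order.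
  - intros A B HAB (d & Hd & H). exists d. auto.
  - intros q. destruct (lt_total q p) as [H|H].
    + right. split; [|order]. exists q. auto.
    + left. split; [|destruct H; order]. destruct (lt_nomin p) as (d & Hd).
      exists d. split; [trivial|]. destruct H; order.
Qed.

(** * Interior of definable subsets of the line *)

Definition has_int (S : M -> Prop) : Prop :=
  exists a b, lt a b /\ forall t, lt a t -> lt t b -> S t.

Lemma has_int_mono (A B : M -> Prop) : (forall t, A t -> B t) -> has_int A -> has_int B.
Proof. intros H (a & b & Hab & HA). exists a, b. auto. Qed.

(** The right germ of [A] at a point [p] of the interval decides: an interval [(p, d)] either lies
    in [A] or misses [A], and then it lies in [B] as long as it stays below [b]. *)
Lemma has_int_or (A B : M -> Prop) :
  defM A -> has_int (fun t => A t \/ B t) -> has_int A \/ has_int B.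
Proof.
  intros HA (a & b & Hab & H). destruct (lt_dense _ _ Hab) as (p & Hap & Hpb).
  destruct (right_germ A p HA) as (d & Hd & [HG|HG]).
  - left. now exists p, d.
  - right. destruct (lt_total d b) as [?|[?|?]].
    + exists p, d. split; [trivial|]. intros t H1 H2.
      destruct (H t) as [?|?]; [order|order| |trivial]. now destruct (HG t).
    + exists p, d. split; [trivial|]. intros t H1 H2.
      destruct (H t) as [?|?]; [order|order| |trivial]. now destruct (HG t).
    + exists p, b. split; [trivial|]. intros t H1 H2.
      destruct (H t) as [?|?]; [order|order| |trivial]. destruct (HG t); trivial. order.
Qed.

(** Neither one-sided germ of [S] at [p] can be full. As [p] may lie outside [S], this makes a
    definable set without interior closed as well as discrete. *)
Lemma no_int_isolated S p : defM S -> ~ has_int S ->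
  exists c d, lt c p /\ lt p d /\ forall t, lt c t -> lt t d -> S t -> t = p.
Proof.
  intros HS HI. destruct (right_germ S p HS) as (d & Hd & [H|HR]).
  { destruct HI. now exists p, d. }
  destruct (left_germ S p HS) as (c & Hc & [H|HL]).
  { destruct HI. now exists c, p. }
  exists c, d. repeat split; trivial. intros t H1 H2 Ht.
  destruct (lt_total t p) as [?|[?|?]]; [|trivial|].
  - destruct (HL t); trivial.
  - destruct (HR t); trivial.
Qed.

Lemma no_int_min S : defM S -> ~ has_int S -> (exists y, S y) ->
  (exists b, forall y, S y -> ~ lt y b) -> exists m, S m /\ forall y, S y -> ~ lt y m.
Proof.
  intros HS HI Hne Hb. destruct (inf_exists S HS Hne Hb) as (s & Hs1 & Hs2).
  exists s. split; [|trivial].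
  destruct (no_int_isolated S s HS HI) as (c & d & Hc & Hd & H).
  destruct (Hs2 d Hd) as (y & Hy & Hyd).
  replace s with y; [trivial|]. apply H; trivial. specialize (Hs1 y Hy). order.
Qed.

(* A definable Baire property.  If no [A r] had interior, the minima of the sets
   [A r] to the right of a point [p] would accumulate at [p], hence fill an
   interval [(p, d)]; but for [t = min (A r)] all later minima lie in [A r]. *)
Lemma nested_cover_has_int (A : M -> M -> Prop) a b :
  defMM A -> (forall r r', (forall t, A r t -> A r' t) \/ (forall t, A r' t -> A r t)) ->
  lt a b -> (forall t, lt a t -> lt t b -> exists r, A r t) -> exists r, has_int (A r).
Proof.
  intros HA Hnest Hab Hcov. apply NNPP. intros HN.
  assert (HI : forall r, ~ has_int (A r)) by (intros r H; apply HN; eauto).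
  clear HN. destruct (lt_dense _ _ Hab) as (p & Hap & Hpb).
  pose (ismin := fun r t => (A r t /\ lt p t /\ lt t b) /\
                            forall s, A r s /\ lt p s /\ lt s b -> ~ lt s t).
  assert (Hmin : forall r t, A r t -> lt p t -> lt t b -> exists m, ismin r m).
  { intros r t H1 H2 H3. apply no_int_min.
    - unfold defM. defn.
    - intros H. apply (HI r). revert H. apply has_int_mono. tauto.
    - eauto.
    - exists p. intros y (_ & Hy & _). order. }
  destruct (right_germ (fun t => exists r, ismin r t) p) as (d & Hd & HG).
  { unfold ismin, defM. defn. }
  assert (Hd' : exists d', lt p d' /\ ~ lt d d' /\ ~ lt b d').
  { destruct (lt_total d b) as [?|[?|?]]; [exists d|exists d|exists b];
      repeat split; trivial; order. }
  destruct Hd' as (d' & Hpd & Hdd & Hbd).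
  destruct HG as [HG|HG].
  - destruct (lt_dense _ _ Hpd) as (t & Hpt & Htd).
    destruct (HG t) as (r & Hr); [trivial|order|].
    apply (HI r). exists t, d'. split; [trivial|]. intros s Hts Hsd.
    destruct (HG s) as (r' & Hr'); [order|order|].
    destruct (Hnest r' r) as [H|H]; [apply H, Hr'|].
    destruct Hr as [(Hr1 & Hr2) _], Hr' as [_ Hr'].
    exfalso. apply (Hr' t); [|trivial]. auto.
  (* Here no minimum lies just to the right of [p], yet a covered point [t] there forces one at or
     below [t]. *)
  - destruct (lt_dense _ _ Hpd) as (t & Hpt & Htd).
    destruct (Hcov t) as (r & Hr); [order|order|].
    destruct (Hmin r t) as (m & Hm); [trivial|trivial|order|].
    destruct (HG m); [apply Hm| |eauto].
    destruct Hm as [_ Hm]. assert (~ lt t m) by (apply Hm; repeat split; trivial; order).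
    order.
Qed.

(** Two nested covers restrict [Z] to a bounded window [[l, u]] whose union still has interior; let
    [s] be the infimum of such [u]. Moving [u] across [s] adds at most the one point [s] of the
    discrete set [Z], so [F s] would have interior. *)
Lemma no_int_union (Z : M -> Prop) (F : M -> M -> Prop) :
  defM Z -> defMM F -> ~ has_int Z -> (forall z, Z z -> ~ has_int (F z)) ->
  ~ has_int (fun t => exists z, Z z /\ F z t).
Proof.
  intros HZ HF HIZ HIF (a & b & Hab & Hcov).
  pose (W := fun l u t => exists z, Z z /\ F z t /\ ~ lt z l /\ ~ lt u z).
  destruct (nested_cover_has_int (fun l t => exists z, Z z /\ F z t /\ ~ lt z l) a b)
    as (l & a' & b' & Hab' & Hl).
  { unfold defMM. defn. }
  { intros r r'. destruct (lt_total r r') as [?|[->|?]]; [right|auto|left];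
      intros t (z & H1 & H2 & H3); exists z; repeat split; trivial; order. }
  { trivial. }
  { intros t H1 H2. destruct (Hcov t H1 H2) as (z & Hz & Hzt). exists z, z.
    repeat split; trivial. apply lt_irrefl. }
  destruct (nested_cover_has_int (W l) a' b') as (u & Hu).
  { unfold defMM, W. defn. }
  { intros r r'. destruct (lt_total r r') as [?|[->|?]]; [left|auto|right];
      intros t (z & H1 & H2 & H3 & H4); exists z; repeat split; trivial; order. }
  { trivial. }
  { intros t H1 H2. destruct (Hl t H1 H2) as (z & Hz & Hzt & Hzl). exists z, z.
    repeat split; trivial. apply lt_irrefl. }
  destruct (inf_exists (fun u => has_int (W l u))) as (s & Hs1 & Hs2).
  { unfold defM, has_int, W. defn. }
  { eauto. }
  { exists l. intros y (c & d & Hcd & Hy) Hyl.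
    destruct (lt_dense _ _ Hcd) as (t & Ht1 & Ht2).
    destruct (Hy t Ht1 Ht2) as (z & _ & _ & H1 & H2). order. }
  destruct (no_int_isolated Z s HZ HIZ) as (c & d & Hc & Hd & Hiso).
  destruct (Hs2 d Hd) as (y1 & Hy1 & Hy1d).
  destruct (lt_dense _ _ Hc) as (y2 & Hcy2 & Hy2).
  destruct (has_int_or (W l y2) (fun t => Z s /\ F s t)) as [H|H].
  - unfold defM, W. defn.
  - revert Hy1. apply has_int_mono. intros t (z & H1 & H2 & H3 & H4).
    destruct (classic (lt y2 z)) as [Hz|Hz].
    + right. rewrite <- (Hiso z); auto; order.
    + left. exists z. auto.
  - apply (Hs1 y2); trivial.
  - destruct H as (c' & d' & Hcd & H). destruct (lt_dense _ _ Hcd) as (t & Ht1 & Ht2).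
    apply (HIF s); [now apply (H t)|]. exists c', d'. split; [trivial|]. apply H.
Qed.

(** A Fubini principle. If the fibres over an interval have interior, nested covers give, over a
    smaller interval, a common length [s] of intervals inside the fibres and bounds [l], [u] for
    their left ends. Near the least possible [u] these intervals share a point [z], and the set of
    [t] with [R t z] has interior. *)
Lemma fibers_with_int (R : M -> M -> Prop) :
  defMM R -> (forall z, ~ has_int (fun t => R t z)) -> ~ has_int (fun t => has_int (R t)).
Proof.
  intros HR HI (a & b & Hab & Hfat).
  pose (box := fun s t x => forall y w, lt x y -> w = add x s -> lt y w -> R t y).
  destruct (nested_cover_has_int (fun s t => lt zero s /\ exists x, box s t x) a b)
    as (s & a1 & b1 & Hab1 & Hs).
  { unfold defMM, box. defn. }
  { assert (Hm : forall r r', lt r' r -> forall t,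
       lt zero r /\ (exists x, box r t x) -> lt zero r' -> exists x, box r' t x).
    { intros r r' Hr t (_ & x & Hx) _. exists x. intros y w H1 -> H2.
      apply (Hx y (add x r)); trivial. apply lt_trans with (add x r'); [trivial|].
      now apply lt_add_l. }
    intros r r'. destruct (classic (lt zero r)) as [Hr|Hr]; [|left; tauto].
    destruct (classic (lt zero r')) as [Hr'|Hr']; [|right; tauto].
    destruct (lt_total r r') as [?|[->|?]]; [right|auto|left];
      intros t Ht; (split; [trivial|]); eapply Hm; eauto. }
  { trivial. }
  { intros t H1 H2. destruct (Hfat t H1 H2) as (x & y & Hxy & Hy).
    exists (add y (opp x)). split.
    - apply (lt_add_r_inv _ _ x). now rewrite sub_cancel, add_comm, add_zero.
    - exists x. intros y' w Hy' -> Hw. rewrite add_comm, sub_cancel in Hw. auto. }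
  assert (Hs0 : lt zero s).
  { destruct (lt_dense _ _ Hab1) as (t & H1 & H2). now apply (Hs t). }
  destruct (nested_cover_has_int (fun l t => exists x, ~ lt x l /\ box s t x) a1 b1)
    as (l & a2 & b2 & Hab2 & Hl).
  { unfold defMM, box. defn. }
  { intros r r'. destruct (lt_total r r') as [?|[->|?]]; [right|auto|left];
      intros t (x & H1 & H2); exists x; (split; [order|trivial]). }
  { trivial. }
  { intros t H1 H2. destruct (Hs t H1 H2) as (_ & x & Hx). exists x, x.
    split; [apply lt_irrefl|trivial]. }
  pose (W := fun u t => exists x, ~ lt x l /\ ~ lt u x /\ box s t x).
  destruct (nested_cover_has_int W a2 b2) as (u & Hu).
  { unfold defMM, W, box. defn. }
  { intros r r'. destruct (lt_total r r') as [?|[->|?]]; [left|auto|right];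
      intros t (x & H1 & H2 & H3); exists x; repeat split; trivial; order. }
  { trivial. }
  { intros t H1 H2. destruct (Hl t H1 H2) as (x & H3 & H4). exists x, x.
    repeat split; trivial. apply lt_irrefl. }
  destruct (inf_exists (fun u => has_int (W u))) as (m & Hm1 & Hm2).
  { unfold defM, has_int, W, box. defn. }
  { eauto. }
  { exists l. intros y (c & d & Hcd & Hy) Hyl.
    destruct (lt_dense _ _ Hcd) as (t & Ht1 & Ht2).
    destruct (Hy t Ht1 Ht2) as (z & H1 & H2 & _). order. }
  (* As [2e < s], an interval of length [s] that starts strictly between [m - e] and [m + e]
     contains [m + e]. This is the shared point of the fibres gained between the bounds [m - e] and
     [y1]. *)
  destruct (small_half s Hs0) as (e & He0 & Hes).
  destruct (Hm2 (add m e)) as (y1 & Hy1 & Hy1m); [now apply lt_add_pos|].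
  assert (Hy2 : lt (add m (opp e)) m).
  { apply (lt_add_r_inv _ _ e). rewrite sub_cancel. now apply lt_add_pos. }
  destruct (has_int_or (W (add m (opp e))) (fun t => R t (add m e))) as [H|H].
  - unfold defM, W, box. defn.
  - revert Hy1. apply has_int_mono. intros t (x & H1 & H2 & H3).
    destruct (classic (lt (add m (opp e)) x)) as [Hx|Hx].
    + right. apply (H3 _ (add x s)); [order|trivial|].
      apply lt_trans with (add (add m (opp e)) s); [|now apply lt_add_r].
      rewrite <- (sub_cancel m e) at 1. rewrite <- add_assoc. now apply lt_add_l.
    + left. exists x. auto.
  - apply (Hm1 (add m (opp e))); trivial.
  - now apply (HI (add m e)).
Qed.

(* For a tuple [v] ending in [z] call the initial part fat over [t] when the
   [z] with [F (v ++ [z]) t] contain an interval.  If for some [t] every finite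
   set lies, together with [t], in a set [F (v ++ [z])] with [v] not fat over
   [t], then the last coordinate can be eliminated by taking the union over
   [z]; otherwise [v |-> {t | v fat over t}] is a family with one coordinate less. *)
Lemma finitely_covering_has_int m (F : list M -> M -> Prop) a b :
  defVM m F -> lt a b ->
  (forall s, (forall t, In t s -> lt a t /\ lt t b) ->
     exists v, length v = m /\ forall t, In t s -> F v t) ->
  exists v, length v = m /\ has_int (F v).
Proof.
  revert F. induction m as [|m IH]; intros F HF Hab Hcov.
  - exists []. split; [trivial|]. exists a, b. split; [trivial|]. intros t H1 H2.
    destruct (Hcov [t]) as (v & Hv & H).
    + intros t' [->|[]]. auto.
    + destruct v; [|discriminate]. apply H. now left.
  - apply NNPP. intros HN.
    assert (HI : forall v z, length v = m -> ~ has_int (F (v ++ [z]))).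
    { intros v z Hv H. apply HN. exists (v ++ [z]). split; [len|trivial]. }
    clear HN. replace (S m) with (m + 1) in HF by lia.
    assert (Hcov' : forall s, (forall t, In t s -> lt a t /\ lt t b) ->
       exists v z, length v = m /\ forall t, In t s -> F (v ++ [z]) t).
    { intros s Hs. destruct (Hcov s Hs) as (v & Hv & H).
      destruct (exists_last (l := v)) as (w & z & ->); [now intros ->|].
      rewrite length_app in Hv. simpl in Hv. exists w, z. split; [lia|trivial]. }
    pose (fat := fun v t => has_int (fun z => F (v ++ [z]) t)).
    assert (Hfat : forall v, length v = m -> ~ has_int (fat v)).
    { intros v Hv. apply (fibers_with_int (fun t z => F (v ++ [z]) t)).
      - unfold defMM. defn.
      - intros z. apply (HI v z Hv). }
    destruct (classic (exists t, lt a t /\ lt t b /\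
        forall s, (forall t', In t' s -> lt a t' /\ lt t' b) ->
          exists v z, length v = m /\ ~ fat v t /\
            forall t', In t' (t :: s) -> F (v ++ [z]) t')) as [(t & Hat & Htb & Ht)|HN].
    + destruct (IH (fun v t' => ~ fat v t /\ exists z, F (v ++ [z]) t /\ F (v ++ [z]) t'))
        as (v & Hv & c & d & Hcd & Hi); trivial.
      * unfold defVM, fat, has_int. defn.
      * intros s Hs. destruct (Ht s Hs) as (v & z & Hv & Hf & H). exists v.
        split; [trivial|]. intros t' Ht'. split; [trivial|]. exists z.
        split; apply H; simpl; auto.
      * destruct (lt_dense _ _ Hcd) as (t0 & H1 & H2).
        assert (Hf : ~ fat v t) by apply (Hi t0 H1 H2).
        apply (no_int_union (fun z => F (v ++ [z]) t) (fun z t' => F (v ++ [z]) t')).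
        -- unfold defM. defn.
        -- unfold defMM. defn.
        -- exact Hf.
        -- intros z _. now apply HI.
        -- exists c, d. split; [trivial|]. apply Hi.
    + assert (HB : forall t, lt a t -> lt t b -> exists s,
        (forall t', In t' s -> lt a t' /\ lt t' b) /\
        forall v z, length v = m -> (forall t', In t' (t :: s) -> F (v ++ [z]) t') -> fat v t).
      { intros t H1 H2. apply NNPP. intros HN'. apply HN. exists t.
        repeat split; trivial. intros s Hs. apply NNPP. intros HN2. apply HN'.
        exists s. split; [trivial|]. intros v z Hv H. apply NNPP. intros Hf.
        apply HN2. exists v, z. auto. }
      (* Enlarging a finite set by the witnesses of its points turns covering into fatness over each
         of them, so [fat] inherits the finite covering property. *)
      assert (HS : forall s, (forall t, In t s -> lt a t /\ lt t b) -> exists s',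
        (forall t, In t s' -> lt a t /\ lt t b) /\
        forall v z, length v = m -> (forall t, In t s' -> F (v ++ [z]) t) ->
          forall t, In t s -> fat v t).
      { induction s as [|t s IHs]; intros Hs.
        - exists []. split; [intros t []|]. intros v z _ _ t [].
        - destruct IHs as (s1 & Hs1 & Hf1); [intros; apply Hs; now right|].
          destruct (HB t) as (s2 & Hs2 & Hf2); try (apply Hs; now left).
          exists (t :: s2 ++ s1). split.
          + intros t' [<-|H]; [apply Hs; now left|].
            apply in_app_iff in H. destruct H; auto.
          + intros v z Hv H t' [<-|Ht'].
            * apply (Hf2 v z Hv). intros t' [<-|Ht']; apply H; [now left|right].
              apply in_or_app. auto.
            * apply (Hf1 v z Hv); trivial. intros t'' Ht''. apply H. right.
              apply in_or_app. auto. }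
      destruct (IH fat) as (v & Hv & Hi); trivial.
      * unfold defVM, fat, has_int. defn.
      * intros s Hs. destruct (HS s Hs) as (s' & Hs' & H).
        destruct (Hcov' s' Hs') as (v & z & Hv & Hvz). exists v. split; [trivial|].
        now apply (H v z).
      * now apply (Hfat v).
Qed.

(** * Definable choice *)

(** With [i] the infimum of [S e], the chosen point is the supremum of the [x] in [[i, i + c]] for
    which [(i, 2x - i)] lies in [S e]: a midpoint of an initial interval obtained without division,
    capped by [c] so that it exists. If it equals [i], no interval of [S e] starts at [i], and then
    [i] itself lies in [S e]. *)
Lemma choice_bounded_below k (S : list M -> M -> Prop) :
  defVM k S -> (forall e, length e = k -> exists b, forall y, S e y -> ~ lt y b) ->
  exists S', defVM k S' /\
    (forall e y, length e = k -> S' e y -> S e y) /\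
    (forall e y y', length e = k -> S' e y -> S' e y' -> y = y') /\
    (forall e y, length e = k -> S e y -> exists y', S' e y').
Proof.
  intros HS Hbd. destruct (lt_nomax zero) as (c & Hc).
  pose (isinf := fun e i => (forall z, S e z -> ~ lt z i) /\
                            (forall u, lt i u -> exists z, S e z /\ lt z u)).
  (* [Q e i x] says that [S e] contains the interval [(i, 2x - i)] *)
  pose (Q := fun e i x => ~ lt x i /\ (forall w, w = add i c -> ~ lt w x) /\
     forall z, lt i z -> forall w1 w2, w1 = add z i -> w2 = add x x -> lt w1 w2 -> S e z).
  pose (issup := fun e i y => (forall x, Q e i x -> ~ lt y x) /\
                              (forall u, lt u y -> exists x, Q e i x /\ lt u x)).
  assert (HQ : forall e i, Q e i i).
  { intros e i. split; [apply lt_irrefl|]. split.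
    - intros w ->. pose proof (lt_add_pos i c Hc). order.
    - intros z Hz w1 w2 -> -> H. apply lt_add_r_inv in H. order. }
  exists (fun e y => exists i, isinf e i /\ issup e i y). repeat split.
  - unfold defVM, isinf, issup, Q. defn.
  - intros e y He (i & [Hi1 Hi2] & [Hy1 Hy2]).
    destruct (lt_total y i) as [H|[->|H]]; [now destruct (Hy1 i)| |].
    + destruct (right_germ (S e) i) as (d & Hd & [HG|HG]).
      * unfold defM. defn.
      * exfalso.
        assert (Hdi : lt zero (add d (opp i))).
        { apply (lt_add_r_inv _ _ i). now rewrite sub_cancel, add_comm, add_zero. }
        (* With [2h < d - i] and [h < c] the point [i + h] satisfies [Q], so the supremum cannot be
           [i]. *)
        assert (Hh : exists h, lt zero h /\ lt (add h h) (add d (opp i)) /\ lt h c).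
        { assert (Hm : exists s, lt zero s /\ ~ lt (add d (opp i)) s /\ ~ lt c s).
          { destruct (lt_total c (add d (opp i))) as [?|[?|?]];
              [exists c|exists c|exists (add d (opp i))]; repeat split; trivial; order. }
          destruct Hm as (s & Hs0 & Hs1 & Hs2). destruct (small_half s Hs0) as (h & Hh & Hhs).
          exists h. pose proof (lt_add_pos h h Hh). repeat split; [trivial|order|order]. }
        destruct Hh as (h & Hh0 & Hhh & Hhc).
        apply (Hy1 (add i h)); [|now apply lt_add_pos].
        pose proof (lt_add_pos i h Hh0). split; [order|]. split.
        -- intros w ->. pose proof (lt_add_l h c i Hhc). order.
        -- intros z Hz w1 w2 -> -> Hw. apply HG; [trivial|].
           rewrite (add_comm i h), add_assoc in Hw. apply lt_add_r_inv in Hw.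
           rewrite <- add_assoc, (add_comm i h), add_assoc in Hw.
           apply (lt_add_r _ _ i) in Hhh. rewrite sub_cancel in Hhh. order.
      * destruct (Hi2 d Hd) as (z & Hz & Hzd). specialize (Hi1 z Hz).
        destruct (lt_total z i) as [?|[->|?]]; [contradiction|trivial|].
        now destruct (HG z).
    + assert (Hyi : lt zero (add y (opp i))).
      { apply (lt_add_r_inv _ _ i). now rewrite sub_cancel, add_comm, add_zero. }
      (* If [2h < y - i] and [x > y - h], then [2x - i > y]: the interval known to lie in [S e]
         reaches past [y]. *)
      destruct (small_half _ Hyi) as (h & Hh0 & Hhh).
      destruct (Hy2 (add y (opp h))) as (x & (_ & _ & Hx) & Hxy).
      { apply (lt_add_r_inv _ _ h). rewrite sub_cancel. now apply lt_add_pos. }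
      apply (Hx y H _ _ eq_refl eq_refl).
      apply lt_trans with (add (add y (opp h)) (add y (opp h))).
      * rewrite <- (sub_cancel y h) at 1. rewrite <- add_assoc. apply lt_add_l.
        apply (lt_add_r_inv _ _ h). rewrite sub_cancel.
        apply (lt_add_r _ _ i) in Hhh. rewrite sub_cancel in Hhh.
        now rewrite <- add_assoc, (add_comm i h), add_assoc.
      * apply lt_add_add; order.
  - intros e y y' He (i & [Hi1 Hi2] & [Hy1 Hy2]) (i' & [Hi1' Hi2'] & [Hy1' Hy2']).
    assert (Hii : i = i').
    { destruct (lt_total i i') as [H|[H|H]]; [|trivial|].
      - destruct (Hi2 _ H) as (z & Hz & Hzi). now destruct (Hi1' z Hz).
      - destruct (Hi2' _ H) as (z & Hz & Hzi). now destruct (Hi1 z Hz). }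
    subst i'. destruct (lt_total y y') as [H|[H|H]]; [|trivial|].
    + destruct (Hy2' _ H) as (z & Hz & Hzi). now destruct (Hy1 z Hz).
    + destruct (Hy2 _ H) as (z & Hz & Hzi). now destruct (Hy1' z Hz).
  - intros e y He Hy. destruct (inf_exists (S e)) as (i & Hi); [unfold defM; defn|eauto|auto|].
    destruct (sup_exists (Q e i)) as (s & Hs).
    + unfold defM, Q. defn.
    + eauto.
    + exists (add i c). intros x (_ & Hx & _). now apply Hx.
    + exists s, i. split; trivial.
Qed.

(** The lower bound is itself chosen: the [r >= 0] such that [S e] has a point at or above [-r] form
    a set bounded below, and a chosen [r] truncates [S e]. *)
Lemma choice_scalar k (S : list M -> M -> Prop) :
  defVM k S ->
  exists S', defVM k S' /\
    (forall e y, length e = k -> S' e y -> S e y) /\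
    (forall e y y', length e = k -> S' e y -> S' e y' -> y = y') /\
    (forall e y, length e = k -> S e y -> exists y', S' e y').
Proof.
  intros HS.
  destruct (choice_bounded_below k (fun e r => ~ lt r zero /\
      exists y, S e y /\ forall w, w = add y r -> ~ lt w zero)) as (R & HR & HR1 & HR2 & HR3).
  { unfold defVM. defn. }
  { intros e _. exists zero. tauto. }
  destruct (choice_bounded_below k (fun e y => S e y /\
      exists r, R e r /\ forall w, w = add y r -> ~ lt w zero)) as (S' & HS' & H1 & H2 & H3).
  { unfold defVM. defn. }
  { intros e He. destruct (classic (exists r, R e r)) as [(r & Hr)|HN].
    - exists (opp r). intros y (_ & r' & Hr' & Hw) Hy.
      rewrite (HR2 e r' r He Hr' Hr) in Hw. apply (Hw _ eq_refl).
      apply (lt_add_r _ _ r) in Hy. now rewrite (add_comm (opp r)), add_opp in Hy.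
    - exists zero. intros y (_ & r & Hr & _). destruct HN. eauto. }
  exists S'. split; [trivial|]. split; [|split; [trivial|]].
  - intros e y He Hy. now apply (H1 e y He).
  - intros e y He Hy.
    assert (Hr : exists r, R e r).
    { destruct (classic (lt y zero)) as [Hy0|Hy0].
      - apply (HR3 e (opp y) He). split.
        + intros H. apply (lt_add_l _ _ y) in H. rewrite add_opp, add_zero in H. order.
        + exists y. split; [trivial|]. intros w ->. rewrite add_opp. apply lt_irrefl.
      - apply (HR3 e zero He). split; [apply lt_irrefl|]. exists y. split; [trivial|].
        intros w ->. now rewrite add_zero. }
    destruct Hr as (r & Hr). destruct (HR1 e r He Hr) as (_ & y1 & Hy1 & Hw).
    apply (H3 e y1 He). split; [trivial|]. eauto.
Qed.

(** Tails are chosen first, uniformly in [e] and the first entry [a]; then [a] is chosen among the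
    entries that admit a tail. *)
Lemma choice_relation n k (Y : list M -> list M -> Prop) :
  defVV k n Y ->
  exists Y', defVV k n Y' /\
    (forall e v, length e = k -> length v = n -> Y' e v -> Y e v) /\
    (forall e v v', length e = k -> length v = n -> length v' = n ->
       Y' e v -> Y' e v' -> v = v') /\
    (forall e v, length e = k -> length v = n -> Y e v ->
       exists v', length v' = n /\ Y' e v').
Proof.
  revert k Y. induction n as [|n IH]; intros k Y HY.
  - exists Y. split; [trivial|]. repeat split; trivial.
    + intros e [|] [|] _; easy.
    + eauto.
  - destruct (IH (k + 1) (fun e v => Y (firstn k e) (skipn k e ++ v)))
      as (Z & HZ & HZ1 & HZ2 & HZ3).
    { unfold defVV. defn. }
    destruct (choice_scalar k (fun e a => exists v, length v = n /\ Z (e ++ [a]) v))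
      as (S & HS & HS1 & HS2 & HS3).
    { unfold defVM. defn. }
    exists (fun e w => S e (nth 0 w zero) /\ Z (e ++ [nth 0 w zero]) (skipn 1 w)).
    repeat split.
    + unfold defVV. defn.
    + intros e [|a v] He Hv (H1 & H2); [discriminate|]. simpl in *.
      apply HZ1 in H2; [|len|lia]. destruct (firstn_skipn_app e [a] k He) as [E1 E2].
      now rewrite E1, E2 in H2.
    + intros e [|a v] [|a' v'] He Hv Hv' (H1 & H2) (H3 & H4); try discriminate.
      simpl in *. rewrite (HS2 e a' a He H3 H1) in *. f_equal.
      apply (HZ2 (e ++ [a])); trivial; try lia. len.
    + intros e [|a v] He Hv Hy; [discriminate|]. simpl in Hv.
      destruct (HZ3 (e ++ [a]) v) as (v1 & Hv1 & Hz1); [len|lia| |].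
      { destruct (firstn_skipn_app e [a] k He) as [-> ->]. trivial. }
      destruct (HS3 e a He) as (a' & Ha'); [eauto|].
      destruct (HS1 e a' He Ha') as (v' & Hv' & Hz). exists (a' :: v'). simpl. auto.
Qed.

Lemma definable_choice k n A (Y : list M -> list M -> Prop) :
  D k A -> defVV k n Y -> (forall e, A e -> exists v, length v = n /\ Y e v) ->
  exists f, (forall e, A e -> length (f e) = n /\ Y e (f e)) /\
    D (k + n) (fun z => exists u, A u /\ z = u ++ f u).
Proof.
  intros HA HY Hex. destruct (choice_relation n k Y HY) as (Y' & HY' & H1 & H2 & H3).
  (* [Y'] has exactly one value of length [n] over each point of [A], so the graph of this classical
     choice is the definable relation [Y'] over [A]. *)
  pose (f := fun e => epsilon (inhabits []) (fun v => length v = n /\ Y' e v)).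
  assert (Hlen : forall e, A e -> length e = k) by (intros e He; exact (st_size D_structure HA He)).
  assert (Hf : forall e, A e -> length (f e) = n /\ Y' e (f e)).
  { intros e He. apply (epsilon_spec (inhabits []) (fun v => length v = n /\ Y' e v)).
    destruct (Hex e He) as (v & Hv & Hy). apply (H3 e v); auto. }
  exists f. split.
  - intros e He. destruct (Hf e He). auto.
  - apply (D_of_definable _ (fun z => A (firstn k z) /\ Y' (firstn k z) (skipn k z))).
    + defn.
    + intros z. split.
      * intros (u & Hu & ->). specialize (Hlen u Hu). destruct (Hf u Hu) as [Hl Hy].
        split; [len|].
        now destruct (firstn_skipn_app u (f u) k Hlen) as [-> ->].
      * intros (Hz & Hu & Hy). exists (firstn k z). split; [trivial|].
        destruct (Hf _ Hu) as [Hl Hy']. rewrite <- (firstn_skipn k z) at 1. f_equal.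
        apply (H2 (firstn k z)); auto. rewrite length_skipn. lia.
Qed.

(** * Compactness of definable topological spaces *)

Variables (n : nat) (X : list M -> Prop) (tau : (list M -> Prop) -> Prop).
Hypothesis HX : D n X.
Hypothesis Htop : is_topology X tau.

Lemma X_length x : X x -> length x = n.
Proof. exact (st_size D_structure HX). Qed.

Lemma set_ext (U V : list M -> Prop) : (forall x, U x <-> V x) -> U = V.
Proof.
  intros H. apply functional_extensionality. intros x. now apply propositional_extensionality.
Qed.

Lemma closed_intersection (F : (list M -> Prop) -> Prop) :
  (forall C, F C -> closed_in X tau C) -> closed_in X tau (fun x => X x /\ forall C, F C -> C x).
Proof.
  intros HF. split; [tauto|].
  replace (fun y => X y /\ ~ (X y /\ forall C, F C -> C y))
    with (fun y => exists U, (exists C, F C /\ U = (fun y => X y /\ ~ C y)) /\ U y).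
  - apply Htop. intros U (C & HC & ->). now apply HF.
  - apply set_ext. intros x. split.
    + intros (U & (C & HC & ->) & Hx & Hn). split; [trivial|]. intros [_ H]. apply Hn. now apply H.
    + intros (Hx & Hn). apply NNPP. intros HN. apply Hn. split; [trivial|].
      intros C HC. apply NNPP. intros Hc. apply HN. exists (fun y => X y /\ ~ C y).
      split; [eauto|auto].
Qed.

(** A point chosen in [Y t] for each [t > 0] gives a curve. Its cluster point at infinity serves a
    decreasing family, the one at 0 an increasing family: the complement of [Y r] is a neighbourhood
    that the curve eventually avoids. *)
Lemma nested_intersection (Y : M -> list M -> Prop) :
  cond_curves lt D n X tau ->
  defVV 1 n (fun e => Y (nth 0 e zero)) ->
  (forall r, lt zero r -> closed_in X tau (Y r) /\ exists x, Y r x) ->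
  (forall r r' x, lt zero r -> lt r r' -> Y r' x -> Y r x) \/
  (forall r r' x, lt zero r -> lt r r' -> Y r x -> Y r' x) ->
  exists x, X x /\ forall r, lt zero r -> Y r x.
Proof.
  intros Hcurves HY Hcl Hmono.
  destruct (definable_choice 1 n (fun e => length e = 1 /\ lt zero (nth 0 e zero))
              (fun e => Y (nth 0 e zero))) as (f & Hf & Hgr).
  { change (definable 1 (fun e => lt zero (nth 0 e zero))). defn. }
  { trivial. }
  { intros e [_ He]. destruct (Hcl _ He) as [[Hx _] (x & Hxy)]. exists x.
    split; [apply X_length|]; auto. }
  assert (Hft : forall t, lt zero t -> Y t (f [t])).
  { intros t Ht. now apply (Hf [t]). }
  assert (Hcurve : def_curve lt D n X (Fin zero) (PInf M) (fun t => f [t])).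
  { split; [exact I|]. split.
    - intros t [Ht _]. simpl in Ht. apply (Hcl t Ht). auto.
    - apply (st_ext D_structure Hgr). intros z. split.
      + intros ([|t [|]] & [Hl Ht] & ->); try discriminate. exists t.
        split; [split; [trivial|exact I]|trivial].
      + intros (t & [Ht _] & ->). exists [t]. repeat split; trivial. }
  assert (Hnb : forall r x, lt zero r -> X x -> ~ Y r x ->
                def_nbhd D n X tau x (fun y => X y /\ ~ Y r y)).
  { intros r x Hr Hx Hn. split.
    - apply (D_of_definable _ (fun y => X y /\ ~ Y r y)).
      + apply definable_and; [now apply definable_of_D|]. apply definable_not.
        refine (definable_appVV n 1 n _ (fun _ => [r]) (fun e => e) HY _ _); tmap.
      + intros y. split; [|tauto]. intros Hy. split; [now apply X_length|trivial].
    - split; [tauto|]. exists (fun y => X y /\ ~ Y r y). split; [apply (Hcl r Hr)|auto]. }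
  destruct (Hcurves _ _ _ Hcurve) as [(x & Hx & Hr) (x' & Hx' & Hl)].
  destruct Hmono as [Hmono|Hmono].
  - exists x. split; [trivial|]. intros r Hr0. apply NNPP. intros Hn.
    destruct (Hr r) with (A := fun y => X y /\ ~ Y r y) as (s & [Hs _] & _ & Hns); auto.
    { now split. }
    apply Hns. simpl in Hs. apply (Hmono r s); trivial. apply Hft. order.
  - exists x'. split; [trivial|]. intros r Hr0. apply NNPP. intros Hn.
    destruct (Hl r) with (A := fun y => X y /\ ~ Y r y) as (s & [Hs0 Hs] & _ & Hns); auto.
    { now split. }
    apply Hns. simpl in Hs, Hs0. apply (Hmono s r); auto.
Qed.

(** Heine-Borel for an ideal: at the supremum of the [y] whose initial segment of [K] lies in [P],
    the local hypothesis pushes the supremum further. Definability is asked of exactly the set whose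
    supremum is taken. *)
Lemma interval_ideal_compact (P : (M -> Prop) -> Prop) (K : M -> Prop) l u :
  (forall A B : M -> Prop, (forall t, A t -> B t) -> P B -> P A) ->
  (forall A B : M -> Prop, P A -> P B -> P (fun t => A t \/ B t)) ->
  defM (fun y => P (fun t => K t /\ ~ lt y t)) ->
  (forall t, K t -> ~ lt t l /\ ~ lt u t) ->
  (forall q, exists c d, lt c q /\ lt q d /\ P (fun t => K t /\ lt c t /\ lt t d)) ->
  P K.
Proof.
  intros Hsub Hun Hdef HK Hloc. apply NNPP. intros HN.
  destruct (sup_exists (fun y => P (fun t => K t /\ ~ lt y t))) as (s & Hs1 & Hs2).
  - trivial.
  - destruct (lt_nomin l) as (y & Hy). exists y.
    destruct (Hloc l) as (c & d & _ & _ & H). apply Hsub with (2 := H).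
    intros t [Ht Hyt]. exfalso. destruct (HK t Ht). order.
  - exists u. intros y Hy Hu. apply HN. apply Hsub with (2 := Hy).
    intros t Ht. split; [trivial|]. destruct (HK t Ht). order.
  - destruct (Hloc s) as (c & d & Hc & Hd & H). destruct (Hs2 c Hc) as (y & Hy & Hcy).
    destruct (lt_dense _ _ Hd) as (y' & Hsy & Hyd).
    apply (Hs1 y'); [|trivial]. apply Hsub with (2 := Hun _ _ Hy H).
    intros t [Ht Hyt]. destruct (classic (lt y t)) as [Hlt|Hlt]; [right|left; auto].
    split; [trivial|]. split; order.
Qed.

(** * From curves to filtered families *)

Section Filtered.
Variables (m : nat) (T : list M -> Prop) (C : list M -> list M -> Prop).
Hypothesis HT : D m T.
Hypothesis HC : defVV m n C.
Hypothesis C_index : forall t x, C t x -> T t.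
Hypothesis C_closed : forall t, T t -> closed_in X tau (C t).
Hypothesis C_nonempty : forall t, T t -> exists x, C t x.
Hypothesis C_filtered : forall s t, T s -> T t ->
  exists u, T u /\ forall y, C u y -> C s y /\ C t y.
Hypothesis T_nonempty : exists t, T t.
Hypothesis Hcurves : cond_curves lt D n X tau.

Definition dominates (v u : list M) : Prop := forall x, length x = n -> C v x -> C u x.

(** Membership in [T] is demanded of the bound; the members inherit it, because the nonempty [C v]
    is contained in their sets. *)
Definition bounded_set (G : list M -> Prop) : Prop :=
  exists v, length v = m /\ (T v /\ forall u, length u = m -> G u -> dominates v u).

Lemma C_X t x : C t x -> X x.
Proof. intros H. exact (proj1 (C_closed t (C_index t x H)) x H). Qed.

Lemma common_dominated v w : T v -> T w ->
  exists u, T u /\ dominates u v /\ dominates u w.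
Proof.
  intros Hv Hw. destruct (C_filtered v w Hv Hw) as (u & Hu & H). exists u.
  split; [trivial|]. split; intros x _ Hx; now apply H.
Qed.

Lemma dominates_trans u v w : dominates u v -> dominates v w -> dominates u w.
Proof. intros H1 H2 x Hx Hu. auto. Qed.

Lemma bounded_set_mono (G H : list M -> Prop) :
  (forall u, G u -> H u) -> bounded_set H -> bounded_set G.
Proof. intros Hs (v & Hv & Tv & HG). exists v. auto. Qed.

Lemma bounded_set_or (G H : list M -> Prop) :
  bounded_set G -> bounded_set H -> bounded_set (fun u => G u \/ H u).
Proof.
  intros (v & Hv & Tv & HG) (w & Hw & Tw & HH).
  destruct (common_dominated v w Tv Tw) as (z & Tz & Hzv & Hzw).
  exists z. split; [exact (st_size D_structure HT Tz)|]. split; [trivial|].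
  intros u Hu [Hg|Hh]; [apply dominates_trans with v|apply dominates_trans with w]; auto.
Qed.

(* Induction on [k], eliminating the last coordinate.  For fixed [p] the points
   [b] near which the sets [G (p ++ [t])] have no common bound form a set
   without interior.  Removing from [[-r, r]] the punctured [s]-neighbourhoods
   of these points leaves parameters [t] for which the union of the
   [G (p ++ [t])] is bounded; finally let [r] tend to infinity and then [s] to 0. *)
Lemma bounded_sets_common_point k : forall G : list M -> list M -> Prop,
  defVV k m G -> (forall w, length w = k -> bounded_set (G w)) ->
  exists x, X x /\ forall w u, length w = k -> length u = m -> G w u -> C u x.
Proof.
  induction k as [|k IH]; intros G HG Hgood.
  { destruct (Hgood [] eq_refl) as (v & Hv & Tv & H).
    destruct (C_nonempty v Tv) as (x & Hx). pose proof (C_X _ _ Hx) as HXx.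
    exists x. split; [trivial|]. intros [|] u Hw Hu Hg; [|discriminate].
    apply (H u); trivial. now apply X_length. }
  replace (S k) with (k + 1) in HG by lia.
  pose (over := fun p (A : M -> Prop) u => exists t, A t /\ G (p ++ [t]) u).
  pose (bad := fun p b => forall c d, lt c b -> lt b d ->
                 ~ bounded_set (over p (fun t => lt c t /\ lt t d))).
  assert (Hbad : defVM k bad).
  { unfold defVM, bad, bounded_set, over, dominates. defn. }
  assert (Hbad_int : forall p, length p = k -> ~ has_int (bad p)).
  { intros p Hp (a & b & Hab & Hb).
    destruct (finitely_covering_has_int m (fun v t => (lt a t /\ lt t b) /\ T v /\
       forall u, length u = m -> G (p ++ [t]) u -> dominates v u) a b)
      as (v & Hv & a' & b' & Hab' & H).
    - unfold defVM, dominates. defn.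
    - trivial.
    (* Finitely many parameters have bounds with a common dominating index, since the family is
       filtered. *)
    - induction s as [|t s IHs]; intros Hs.
      + destruct T_nonempty as (v & Tv). exists v. split; [exact (st_size D_structure HT Tv)|].
        intros t [].
      + destruct IHs as (v & Hv & Hvs); [intros; apply Hs; now right|].
        destruct (Hgood (p ++ [t])) as (w & Hw & Tw & Hwt); [len|].
        (* The induction hypothesis yields [T v] only through an element of [s], so an empty [s] is
           treated separately. *)
        assert (Hz : exists z, T z /\ dominates z w /\ (forall t, In t s -> dominates z v)).
        { destruct s as [|t' s].
          - exists w. split; [trivial|]. split; [intros x; auto|]. intros t' [].
          - destruct (Hvs t') as (_ & Tv & _); [now left|].
            destruct (common_dominated w v Tw Tv) as (z & Tz & H1 & H2). eauto. }
        destruct Hz as (z & Tz & Hzw & Hzv). exists z.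
        split; [exact (st_size D_structure HT Tz)|]. intros t' Ht'. split; [now apply Hs|].
        split; [trivial|]. intros u Hu Hg. destruct Ht' as [<-|Ht'].
        * apply dominates_trans with w; auto.
        * apply dominates_trans with v; [apply (Hzv t' Ht')|].
          now apply (Hvs t' Ht').
    - destruct (lt_dense _ _ Hab') as (t & H1 & H2).
      destruct (H t H1 H2) as ((Hat & Htb) & Tv & _).
      apply (Hb t Hat Htb a' b' H1 H2). exists v. split; [trivial|]. split; [trivial|].
      intros u Hu (t' & (H3 & H4) & Hg). now apply (H t' H3 H4). }
  (* This says [-r <= t <= r], and each bad [b] is [t] itself or at distance at least [s] from [t].
     Allowing [b = t] lets these sets exhaust the line. *)
  pose (K := fun s r p t => (forall w, w = add t r -> ~ lt w zero) /\ ~ lt r t /\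
     forall b, bad p b -> b = t \/ (forall w, w = add b s -> ~ lt t w) \/
                          (forall w, w = add t s -> ~ lt b w)).
  assert (HK : forall s r p, length p = k -> lt zero s -> bounded_set (over p (K s r p))).
  { intros s r p Hp Hs.
    apply (interval_ideal_compact (fun A => bounded_set (over p A)) (K s r p) (opp r) r).
    - intros A B HAB. apply bounded_set_mono. intros u (t & Ht & Hg). exists t. auto.
    - intros A B HA HB. apply bounded_set_mono with (2 := bounded_set_or _ _ HA HB).
      intros u (t & [Ht|Ht] & Hg); [left|right]; exists t; auto.
    - unfold defM, bounded_set, over, K, dominates. defn.
    - intros t (H1 & H2 & _). split; [|trivial]. intros Ht. apply (H1 _ eq_refl).
      apply (lt_add_r _ _ r) in Ht. now rewrite (add_comm (opp r)), add_opp in Ht.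
    - intros q. destruct (classic (bad p q)) as [Hq|Hq].
      (* Around a bad [q] only [t = q] survives in [K], and [G (p ++ [q])] is bounded by
         hypothesis. *)
      + exists (add q (opp s)), (add q s). split.
        { apply (lt_add_r_inv _ _ s). rewrite sub_cancel. now apply lt_add_pos. }
        split; [now apply lt_add_pos|].
        apply bounded_set_mono with (2 := Hgood (p ++ [q]) ltac:(len)).
        intros u (t & ((_ & _ & Ht) & H1 & H2) & Hg).
        destruct (Ht q Hq) as [->|[H|H]]; [trivial|now destruct (H _ eq_refl)|].
        destruct (H _ eq_refl). apply (lt_add_r _ _ s) in H1.
        now rewrite sub_cancel in H1.
      + apply NNPP. intros HN. apply Hq. intros c d Hc Hd Hb. apply HN. exists c, d.
        repeat split; trivial. revert Hb. apply bounded_set_mono.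
        intros u (t & (_ & Ht) & Hg). exists t. auto. }
  assert (HKex : forall p t, length p = k -> exists s r, lt zero s /\ lt zero r /\ K s r p t).
  { intros p t Hp.
    (* [s] will be the smaller distance from [t] to the ends of a neighbourhood containing no bad
       point other than possibly [t]. *)
    destruct (no_int_isolated (bad p) t) as (c & d & Hc & Hd & H); [unfold defM; defn|auto|].
    assert (Hs : exists s, lt zero s /\ ~ lt t (add c s) /\ ~ lt d (add t s)).
    { assert (H1 : lt zero (add t (opp c))).
      { apply (lt_add_r_inv _ _ c). now rewrite sub_cancel, add_comm, add_zero. }
      assert (H2 : lt zero (add d (opp t))).
      { apply (lt_add_r_inv _ _ t). now rewrite sub_cancel, add_comm, add_zero. }
      assert (E1 : forall s, ~ lt (add t (opp c)) s -> ~ lt t (add c s)).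
      { intros s Hs Hl. apply Hs, (lt_add_r_inv _ _ c).
        now rewrite sub_cancel, add_comm. }
      assert (E2 : forall s, ~ lt (add d (opp t)) s -> ~ lt d (add t s)).
      { intros s Hs Hl. apply Hs, (lt_add_r_inv _ _ t).
        now rewrite sub_cancel, add_comm. }
      destruct (classic (lt (add t (opp c)) (add d (opp t)))) as [Hl|Hl].
      - exists (add t (opp c)). split; [trivial|]. split; [apply E1|apply E2]; order.
      - exists (add d (opp t)). split; [trivial|]. split; [apply E1|apply E2]; order. }
    destruct Hs as (s & Hs0 & Hs1 & Hs2).
    assert (Hr : exists r, lt zero r /\ lt t r /\ lt (opp t) r).
    { assert (Hmax : forall a b, exists r, lt a r /\ lt b r).
      { intros a b. destruct (lt_nomax a) as (a' & Ha), (lt_nomax b) as (b' & Hb).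
        destruct (classic (lt a' b')); [exists b'|exists a']; split; order. }
      destruct (Hmax zero t) as (r1 & H1 & H2), (Hmax r1 (opp t)) as (r & H3 & H4).
      exists r. repeat split; order. }
    destruct Hr as (r & Hr0 & Hr1 & Hr2). exists s, r. repeat split; trivial.
    - intros w -> Hw. apply (lt_add_l _ _ t) in Hr2. rewrite add_opp in Hr2. order.
    - order.
    - intros b Hb. destruct (classic (lt c b)) as [Hcb|Hcb].
      + destruct (classic (lt b d)) as [Hbd|Hbd].
        * left. now apply H.
        * right. right. intros w ->. order.
      + right. left. intros w -> Hw.
        destruct (lt_total b c) as [Hl|[->|Hl]]; [|contradiction|contradiction].
        apply (lt_add_r _ _ s) in Hl. order. }
  assert (HKr : forall s r r' p t, lt r r' -> K s r p t -> K s r' p t).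
  { intros s r r' p t Hr (H1 & H2 & H3). split; [|split; [order|trivial]].
    intros w -> Hw. apply (H1 _ eq_refl). apply (lt_add_l _ _ t) in Hr. order. }
  assert (HKs : forall s s' r p t, lt s' s -> K s r p t -> K s' r p t).
  { intros s s' r p t Hs (H1 & H2 & H3). repeat split; trivial.
    intros b Hb. destruct (H3 b Hb) as [H|[H|H]]; [auto|right; left|right; right];
      intros w -> Hw; apply (H _ eq_refl).
    - apply (lt_add_l _ _ b) in Hs. order.
    - apply (lt_add_l _ _ t) in Hs. order. }
  pose (Y := fun s r x => X x /\
     forall p, length p = k -> forall u, length u = m -> over p (K s r p) u -> C u x).
  assert (HYne : forall s r, lt zero s -> exists x, Y s r x).
  { intros s r Hs. destruct (IH (fun p => over p (K s r p))) as (x & HXx & Hx).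
    - unfold defVV, over, K. defn.
    - auto.
    - exists x. split; [trivial|]. intros p Hp u Hu Ho. exact (Hx p u Hp Hu Ho). }
  assert (HYcl : forall s r, lt zero s -> closed_in X tau (Y s r)).
  { intros s r Hs.
    replace (Y s r) with (fun x => X x /\ forall E, (exists p u, length p = k /\
      length u = m /\ over p (K s r p) u /\ E = C u) -> E x).
    - apply closed_intersection. intros E (p & u & Hp & Hu & Ho & ->). apply C_closed.
      destruct (HK s r p Hp Hs) as (v & Hv & Tv & H).
      destruct (C_nonempty v Tv) as (x & Hx). apply (C_index u x).
      apply (H u Hu Ho); [|trivial]. apply X_length, (C_X _ _ Hx).
    - apply set_ext. intros x. unfold Y. split.
      + intros [HXx H]. split; [trivial|]. intros p Hp u Hu Ho. apply H. eauto 6.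
      + intros [HXx H]. split; [trivial|]. intros E (p & u & Hp & Hu & Ho & ->). eauto. }
  pose (Z := fun s x => X x /\ forall r, lt zero r -> Y s r x).
  assert (HZne : forall s, lt zero s -> exists x, Z s x).
  { intros s Hs. apply (nested_intersection (Y s)); trivial.
    - unfold defVV, Y, over, K. defn.
    - intros r _. auto.
    - left. intros r r' x _ Hr (HXx & H). split; [trivial|].
      intros p Hp u Hu (t & Ht & Hg). apply (H p Hp u Hu). exists t. split; [|trivial].
      eapply HKr; eauto. }
  assert (HZcl : forall s, lt zero s -> closed_in X tau (Z s)).
  { intros s Hs.
    replace (Z s) with (fun x => X x /\ forall E, (exists r, lt zero r /\ E = Y s r) -> E x).
    - apply closed_intersection. intros E (r & Hr & ->). auto.
    - apply set_ext. intros x. unfold Z. split.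
      + intros [HXx H]. split; [trivial|]. intros r Hr. apply H. eauto.
      + intros [HXx H]. split; [trivial|]. intros E (r & Hr & ->). auto. }
  destruct (nested_intersection Z) as (x & HXx & Hx); trivial.
  - unfold defVV, Z, Y, over, K. defn.
  - auto.
  - right. intros s s' x _ Hs (HXx & H). split; [trivial|]. intros r Hr.
    destruct (H r Hr) as (_ & Hy). split; [trivial|].
    intros p Hp u Hu (t & Ht & Hg). apply (Hy p Hp u Hu). exists t. split; [|trivial].
    eapply HKs; eauto.
  - exists x. split; [trivial|]. intros w u Hw Hu Hg.
    destruct (exists_last (l := w)) as (p & t & ->); [now intros ->|].
    rewrite length_app in Hw. simpl in Hw. assert (Hp : length p = k) by lia.
    destruct (HKex p t Hp) as (s & r & Hs & Hr & Ht).
    destruct (Hx s Hs) as (_ & Hz). destruct (Hz r Hr) as (_ & Hy).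
    apply (Hy p Hp u Hu). exists t. auto.
Qed.

(** The singletons [{w}] for [w] in [T], with the empty set for other [w], are a family of bounded
    sets parametrised by [M^m]. *)
Lemma filtered_intersection : exists x, X x /\ forall t, T t -> C t x.
Proof.
  destruct (bounded_sets_common_point m (fun w u => T w /\ w = u)) as (x & HXx & Hx).
  - unfold defVV. apply definable_and; [defn|]. 
    apply (definable_eq_vec (m + m) m (fun e => firstn m e) (fun e => skipn m e)); tmap.
  - intros w Hw. destruct (classic (T w)) as [Tw|Tw].
    + exists w. repeat split; trivial. intros u _ [_ <-]. now intros x.
    + destruct T_nonempty as (v & Tv). exists v. split; [exact (st_size D_structure HT Tv)|].
      split; [trivial|]. now intros u _ [? _].
  - exists x. split; [trivial|]. intros t Ht. pose proof (st_size D_structure HT Ht).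
    now apply (Hx t t).
Qed.

End Filtered.

(** The values of [C] outside [T] are unconstrained, so the family is cut down to [T t /\ C t x],
    which provides [C_index]. *)
Lemma filtered_of_curves : cond_curves lt D n X tau -> cond_filtered D n X tau.
Proof.
  intros Hcurves m T C Hfam Hne Hcl Hfil.
  assert (Hext : forall t, T t -> (fun x => T t /\ C t x) = C t).
  { intros t Ht. apply set_ext. tauto. }
  destruct (filtered_intersection m T (fun t x => T t /\ C t x)) as (x & HXx & Hx); trivial.
  - apply Hfam.
  - apply defVV_of_family; [trivial|]. intros t x Ht Hx. apply X_length.
    now apply (proj1 (proj1 (Hcl t Ht))).
  - tauto.
  - intros t Ht. rewrite Hext by trivial. now apply Hcl.
  - intros t Ht. destruct (Hcl t Ht) as [_ (x & Hx)]. eauto.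
  - intros s t Hs Ht. destruct (Hfil s t Hs Ht) as (u & Hu & H). exists u.
    split; [trivial|]. intros y [_ Hy]. destruct (H y Hy). auto.
  - exists x. split; [trivial|]. intros t Ht. now apply Hx.
Qed.

(** * From nets to filtered families *)

Lemma D_pairs k l R : defVV k l R ->
  (forall u v, R u v -> length u = k /\ length v = l) ->
  D (k + l) (fun z => exists u v, z = u ++ v /\ R u v).
Proof.
  intros HR Hl. apply (D_of_definable _ _ _ HR). intros z. split.
  - intros (u & v & -> & Huv). destruct (Hl u v Huv) as [Hu Hv].
    destruct (firstn_skipn_app u v k Hu) as [-> ->]. split; [len|trivial].
  - intros [Hz H]. exists (firstn k z), (skipn k z). now rewrite firstn_skipn.
Qed.

Lemma family_of_defVV k T C : D k T -> defVV k n C -> (forall t x, C t x -> X x) ->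
  def_family D k n T C.
Proof.
  intros HT HC HCX. split; [trivial|]. apply (D_pairs k n (fun t x => T t /\ C t x)).
  - unfold defVV. defn.
  - intros t x [Ht Hx]. split; [exact (st_size D_structure HT Ht)|]. apply X_length. eauto.
Qed.

Lemma directed_finite (Om : list M -> Prop) (le : list M -> list M -> Prop) :
  (exists u, Om u) ->
  (forall u v w, Om u -> Om v -> Om w -> le u v -> le v w -> le u w) ->
  (forall u v, Om u -> Om v -> exists w, Om w /\ le w u /\ le w v) ->
  forall s, (forall u, In u s -> Om u) -> exists l, Om l /\ forall u, In u s -> le l u.
Proof.
  intros (u0 & Hu0) Htr Hdir s. induction s as [|u s IH]; intros Hs.
  - exists u0. split; [trivial|]. intros u [].
  - destruct IH as (l & Hl & H); [intros; apply Hs; now right|].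
    destruct (Hdir u l) as (w & Hw & Hwu & Hwl); [apply Hs; now left|trivial|].
    exists w. split; [trivial|]. intros v [<-|Hv]; [trivial|].
    apply (Htr w l v); auto. apply Hs. now right.
Qed.

(** [T] is directed by inclusion of the sets, and the net picks a point of each. A limit of a subnet
    outside some [C t] would have the complement of [C t] as a neighbourhood, while cofinality keeps
    late values inside [C t]. *)
Lemma filtered_of_nets : cond_nets D n X tau -> cond_filtered D n X tau.
Proof.
  intros Hnets m T C Hfam (t0 & Ht0) Hcl Hfil.
  assert (HT : D m T) by apply Hfam.
  assert (HCX : forall t x, T t -> C t x -> X x) by (intros t x Ht; apply (Hcl t Ht)).
  assert (HC : defVV m n (fun t x => T t /\ C t x)).
  { apply defVV_of_family; [trivial|]. intros t x Ht Hx. apply X_length. eauto. }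
  set (C' := fun t x => T t /\ C t x) in HC.
  destruct (definable_choice m n T C' HT HC) as (g & Hg & Hgr).
  { intros t Ht. destruct (Hcl t Ht) as [_ (x & Hx)]. exists x.
    split; [apply X_length; eauto|now split]. }
  destruct (Hnets m T (fun s t => forall y, length y = n -> C' s y -> C' t y) g)
    as (k' & Om & le & f & Hdir & (HOm & HfT & _) & Hcof & x & HXx & Hconv).
  - split; [trivial|]. split; [eauto|]. split; [|split; [auto|split; [auto|]]].
    + apply (st_ext D_structure (D_pairs m m (fun s t => T s /\ T t /\
        forall y, length y = n -> C' s y -> C' t y) ltac:(unfold defVV; defn)
        ltac:(intros u v (Hu & Hv & _); split; eapply (st_size D_structure); eauto))).
      intros z. split.
      * intros (u & v & Hz & Hu & Hv & H). eauto 7.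
      * intros (u & v & Hu & Hv & H & Hz). eauto 7.
    + apply directed_finite; [eauto|auto|]. intros s t Hs Ht.
      destruct (Hfil s t Hs Ht) as (u & Hu & H). exists u. split; [trivial|].
      split; intros y _ [_ Hy]; (split; [trivial|]); now apply H.
  - split; [trivial|]. split; [|trivial]. intros t Ht. destruct (Hg t Ht) as [_ [_ H]]. eauto.
  - exists x. split; [trivial|]. intros t Ht. apply NNPP. intros Hn.
    destruct (Hconv (fun y => X y /\ ~ C t y)) as (uA & HuA & HA).
    + split; [|split; [tauto|]].
      * apply (D_of_definable _ (fun y => X y /\ ~ C' t y)).
        -- pose proof (st_size D_structure HT Ht). defn.
        -- intros y. unfold C'. split; [|tauto]. intros [HXy Hy].
           split; [now apply X_length|tauto].
      * exists (fun y => X y /\ ~ C t y). split; [apply (Hcl t Ht)|auto].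
    + destruct (Hcof t Ht) as (v & Hv & Hvt).
      destruct Hdir as (_ & _ & _ & _ & _ & Hlow).
      destruct (Hlow [uA; v]) as (w & Hw & Hle).
      { intros u [<-|[<-|[]]]; trivial. }
      destruct (HA w Hw) as [_ HAw]; [apply Hle; simpl; auto|]. apply HAw.
      destruct (Hg (f w)) as [Hl Hgw]; [auto|].
      apply (Hvt w Hw (Hle v ltac:(simpl; auto)) _ Hl Hgw).
Qed.

(** * Closures from a definable base; from filtered families to curves and nets *)

Variables (m0 : nat) (T0 : list M -> Prop) (B : list M -> list M -> Prop).
Hypothesis HB : def_family D m0 n T0 B.
Hypothesis B_open : forall t, T0 t -> tau (B t).
Hypothesis B_base : forall U x, tau U -> U x ->
  exists t, T0 t /\ B t x /\ forall y, B t y -> U y.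

Definition base (t x : list M) : Prop := T0 t /\ B t x.

Lemma base_X t x : base t x -> X x.
Proof. intros [Ht Hx]. exact (proj1 Htop _ (B_open t Ht) x Hx). Qed.

Lemma defVV_base : defVV m0 n base.
Proof.
  apply defVV_of_family; [trivial|]. intros t x Ht Hx. now apply X_length, (base_X t).
Qed.

Lemma base_length t x : base t x -> length t = m0.
Proof. intros [Ht _]. exact (st_size D_structure (proj1 HB) Ht). Qed.

Lemma base_refine U x : tau U -> U x -> exists t, base t x /\ forall y, base t y -> U y.
Proof.
  intros HU Hx. destruct (B_base U x HU Hx) as (t & Ht & Hb & H). exists t.
  split; [now split|]. intros y [_ Hy]. auto.
Qed.

(** Closure tested on indices of basic open sets, hence by a formula: the closures of a definable
    family form a definable family. *)
Definition cl (S : list M -> Prop) (x : list M) : Prop :=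
  X x /\ forall t, length t = m0 -> base t x -> exists y, length y = n /\ (base t y /\ S y).

Lemma cl_closed S : closed_in X tau (cl S).
Proof.
  split; [unfold cl; tauto|].
  replace (fun y => X y /\ ~ cl S y)
    with (fun y => exists U, (exists t, T0 t /\ U = B t /\ forall y, B t y -> ~ S y) /\ U y).
  - apply Htop. intros U (t & Ht & -> & _). auto.
  - apply set_ext. intros x. split.
    + intros (U & (t & Ht & -> & H) & Hx). split; [now apply (base_X t)|].
      intros [_ Hc]. destruct (Hc t) as (y & _ & [_ Hy] & HS).
      * exact (st_size D_structure (proj1 HB) Ht).
      * now split.
      * now apply (H y).
    + intros [HXx Hn]. apply NNPP. intros HN. apply Hn. split; [trivial|].
      intros t Ht [HTt Hb]. apply NNPP. intros HN2. apply HN. exists (B t).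
      split; [|trivial]. exists t. repeat split; trivial. intros y Hy HS. apply HN2.
      exists y. split; [now apply X_length, (base_X t)|]. now repeat split.
Qed.

Lemma subset_cl S x : X x -> S x -> cl S x.
Proof. intros HXx HS. split; [trivial|]. intros t _ Hb. exists x. auto using X_length. Qed.

Lemma cl_mono (S S' : list M -> Prop) x : (forall y, S y -> S' y) -> cl S x -> cl S' x.
Proof.
  intros H [HXx Hc]. split; [trivial|]. intros t Ht Hb.
  destruct (Hc t Ht Hb) as (y & Hy & Hby & HS). eauto.
Qed.

Lemma cl_meets_nbhd S x A : cl S x -> def_nbhd D n X tau x A -> exists y, A y /\ S y.
Proof.
  intros [HXx Hc] (_ & _ & U & HU & Hx & HUA).
  destruct (base_refine U x HU Hx) as (t & Hb & Ht).
  destruct (Hc t (base_length _ _ Hb) Hb) as (y & _ & Hby & HS). eauto.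
Qed.

Lemma definable_in_int k a b (f : list M -> M) :
  tuple_map k 1 (fun e => [f e]) -> definable k (fun e => Defs.in_int lt a b (f e)).
Proof.
  intros Hf. unfold Defs.in_int.
  apply definable_and; [destruct a|destruct b]; simpl;
    try apply definable_const; apply definable_lt; trivial; tmap.
Qed.

(** [rel t s] reads: [s] lies beyond [t] towards the chosen end, so one proof serves both ends. The
    closures of the tails of [g] are a filtered family, and a common point is a cluster point. *)
Lemma curve_cluster_point (rel : M -> M -> Prop) a b g :
  cond_filtered D n X tau -> def_curve lt D n X a b g -> defMM rel ->
  (forall t, Defs.in_int lt a b t -> exists s, Defs.in_int lt a b s /\ rel t s) ->
  (forall t t' s, rel t t' -> rel t' s -> rel t s) ->
  (forall t t', Defs.in_int lt a b t -> Defs.in_int lt a b t' -> rel t t' \/ t = t' \/ rel t' t) ->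
  (exists t, Defs.in_int lt a b t) ->
  exists x, X x /\ forall t, Defs.in_int lt a b t -> forall A, def_nbhd D n X tau x A ->
    exists s, Defs.in_int lt a b s /\ rel t s /\ A (g s).
Proof.
  intros Hfil (_ & HgX & Hgr) Hrel Hne Htr Htot (t0 & Ht0).
  set (Gr := fun z => exists t, Defs.in_int lt a b t /\ z = t :: g t) in Hgr.
  pose proof defVV_base as Hbase.
  destruct (Hfil 1 (fun e => length e = 1 /\ Defs.in_int lt a b (nth 0 e zero))
    (fun e => cl (fun y => exists s, rel (nth 0 e zero) s /\ Gr (s :: y)))) as (x & HXx & Hx).
  - apply family_of_defVV.
    + apply definable_in_int. tmap.
    + unfold defVV, cl. defn.
    + now intros t x [? _].
  - exists [t0]. auto.
  - intros e [_ He]. split; [apply cl_closed|]. destruct (Hne _ He) as (s & Hs & Hr).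
    exists (g s). apply subset_cl; [auto|]. exists s. split; [trivial|]. now exists s.
  - intros s t [Hls Hs] [Hlt Ht].
    destruct (Htot _ _ Hs Ht) as [H|[H|H]]; [exists t|exists t|exists s]; (split; [auto|]);
      intros y Hy; split; trivial; revert Hy; apply cl_mono; intros z (w & Hw & Hz);
      exists w; (split; [|trivial]); eauto; congruence.
  - exists x. split; [trivial|]. intros t Ht A HA.
    destruct (cl_meets_nbhd _ x A (Hx [t] (conj eq_refl Ht)) HA) as (y & Hy & s & Hr & s' & Hs & E).
    injection E as -> ->. eauto.
Qed.

Lemma curves_of_filtered : cond_filtered D n X tau -> cond_curves lt D n X tau.
Proof.
  intros Hfil a b g Hg.
  assert (Hmid : forall c d, elt lt c d -> exists t, Defs.in_int lt c d t).
  { intros [|c|] [|d|] H; simpl in H; try easy; unfold Defs.in_int; simpl.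
    - destruct (lt_nomin d) as (t & Ht). eauto.
    - now exists zero.
    - destruct (lt_dense _ _ H) as (t & Ht). eauto.
    - destruct (lt_nomax c) as (t & Ht). eauto. }
  assert (Htr : forall c d e, elt lt c d -> elt lt d e -> elt lt c e).
  { intros [|c|] [|d|] [|e|]; simpl; try easy. apply lt_trans. }
  split.
  - destruct (curve_cluster_point lt a b g) as (x & HXx & Hx); trivial.
    + unfold defMM. defn.
    + intros t [H1 H2]. destruct (Hmid _ _ H2) as (s & H3 & H4). exists s.
      repeat split; trivial. eapply Htr; eauto.
    + intros. order.
    + intros. apply lt_total.
    + apply Hmid, Hg.
    + exists x. split; [trivial|]. intros t Ht A HA.
      destruct (Hx t Ht A HA) as (s & [_ Hs] & Hts & HAs). exists s. repeat split; trivial.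
  - destruct (curve_cluster_point (fun t s => lt s t) a b g) as (x & HXx & Hx); trivial.
    + unfold defMM. defn.
    + intros t [H1 H2]. destruct (Hmid _ _ H1) as (s & H3 & H4). exists s.
      repeat split; trivial. eapply Htr; eauto.
    + intros. order.
    + intros t t' _ _. destruct (lt_total t t') as [?|[?|?]]; auto.
    + apply Hmid, Hg.
    + exists x. split; [trivial|]. intros t Ht A HA.
      destruct (Hx t Ht A HA) as (s & [Hs _] & Hts & HAs). exists s. repeat split; trivial.
Qed.

(* The subnet is indexed by the pairs [(v, p)] with [p] a basic neighbourhood of
   the cluster point containing [g v]. *)
Lemma nets_of_filtered : cond_filtered D n X tau -> cond_nets D n X tau.
Proof.
  intros Hfil k Om le g (HOm & (u0 & Hu0) & Hle & Hrefl & Htr & Hlow) (_ & HgX & Hgr).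
  (* The order and the net are arbitrary outside [Om], so formulas refer to their definable
     graphs. *)
  set (LE := fun z => exists u v, Om u /\ Om v /\ le u v /\ z = u ++ v) in Hle.
  set (Gr := fun z => exists u, Om u /\ z = u ++ g u) in Hgr.
  pose proof defVV_base as Hbase.
  assert (Hk : forall u, Om u -> length u = k) by (intros u Hu; exact (st_size D_structure HOm Hu)).
  assert (HLE : forall u v, length u = k -> (LE (u ++ v) <-> Om u /\ Om v /\ le u v)).
  { intros u v Hl. split.
    - intros (u' & v' & Hu & Hv & H & E).
      destruct (firstn_skipn_app u v k Hl) as [E1 E2].
      destruct (firstn_skipn_app u' v' k (Hk _ Hu)) as [E3 E4].
      rewrite <- E, E1 in E3. rewrite <- E, E2 in E4. now subst.
    - intros (Hu & Hv & H). exists u, v. auto. }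
  assert (HGr : forall u y, length u = k -> (Gr (u ++ y) <-> Om u /\ y = g u)).
  { intros u y Hl. split.
    - intros (u' & Hu & E).
      destruct (firstn_skipn_app u y k Hl) as [E1 E2].
      destruct (firstn_skipn_app u' (g u') k (Hk _ Hu)) as [E3 E4].
      rewrite <- E, E1 in E3. rewrite <- E, E2 in E4. now subst.
    - intros (Hu & ->). now exists u. }
  assert (Hdir2 : forall u v, Om u -> Om v -> exists w, Om w /\ le w u /\ le w v).
  { intros u v Hu Hv. destruct (Hlow [u; v]) as (w & Hw & H).
    - intros z [<-|[<-|[]]]; trivial.
    - exists w. split; [trivial|]. split; apply H; simpl; auto. }
  (* Closures of the tails of the net; a common point [x] is a cluster point. *)
  destruct (Hfil k Om (fun u => cl (fun y => exists v, length v = k /\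
      (LE (v ++ u) /\ Gr (v ++ y))))) as (x & HXx & Hx).
  { apply family_of_defVV; [trivial| |].
    - unfold defVV, cl. defn.
    - now intros t x [? _]. }
  { eauto. }
  { intros u Hu. split; [apply cl_closed|]. exists (g u). apply subset_cl; [auto|].
    exists u. rewrite HLE, HGr; auto. repeat split; auto. }
  { intros u v Hu Hv. destruct (Hdir2 u v Hu Hv) as (w & Hw & Hwu & Hwv).
    exists w. split; [trivial|].
    intros y Hy; split; revert Hy; apply cl_mono; intros z (v' & Hl & H1 & H2);
      exists v'; rewrite HLE in * by trivial; repeat split; trivial; try apply H1;
      apply (Htr v' w); tauto. }
  assert (Hcl : forall u p, Om u -> base p x ->
            exists v, Om v /\ le v u /\ base p (g v)).
  { intros u p Hu Hp. destruct (Hx u Hu) as [_ H].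
    destruct (H p (base_length _ _ Hp) Hp) as (y & _ & Hb & v & Hv & H1 & H2).
    rewrite HLE in H1 by trivial. rewrite HGr in H2 by trivial. destruct H2 as [_ ->].
    exists v. tauto. }
  pose (Om' := fun w => length w = k + m0 /\ (base (skipn k w) x /\
     exists y, length y = n /\ (Gr (firstn k w ++ y) /\ base (skipn k w) y))).
  (* The order of [Om] on the first component, inclusion of basic neighbourhoods on the second. *)
  pose (le' := fun w1 w2 => LE (firstn k w1 ++ firstn k w2) /\
     forall y, length y = n -> base (skipn k w1) y -> base (skipn k w2) y).
  assert (HOm' : D (k + m0) Om') by (unfold Om'; change (definable (k + m0) (fun w =>
     base (skipn k w) x /\
     exists y, length y = n /\ (Gr (firstn k w ++ y) /\ base (skipn k w) y)));
     pose proof (X_length x HXx); defn).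
  assert (Hin : forall v p, Om v -> base p x -> base p (g v) -> Om' (v ++ p)).
  { intros v p Hv Hp Hb. pose proof (Hk v Hv). pose proof (base_length _ _ Hp).
    split; [len|]. destruct (firstn_skipn_app v p k) as [-> ->]; [trivial|].
    split; [trivial|]. exists (g v). split; [now apply X_length, HgX|].
    split; [|trivial]. now apply HGr. }
  assert (Hout : forall w, Om' w -> Om (firstn k w) /\ base (skipn k w) x /\
            base (skipn k w) (g (firstn k w))).
  { intros w (Hl & Hb & y & _ & Hg & Hy). apply HGr in Hg.
    - destruct Hg as [Ho ->]. auto.
    - rewrite length_firstn. lia. }
  assert (Hle' : forall w1 w2, Om' w1 -> Om' w2 -> (le' w1 w2 <->
     le (firstn k w1) (firstn k w2) /\
     forall y, base (skipn k w1) y -> base (skipn k w2) y)).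
  { intros w1 w2 H1 H2. destruct (Hout w1 H1) as (HO1 & _), (Hout w2 H2) as (HO2 & _).
    unfold le'. rewrite HLE by auto. split.
    - intros ((_ & _ & H) & Hy). split; [trivial|]. intros y Hb. apply Hy; [|trivial].
      now apply X_length, (base_X _ _ Hb).
    - intros (H & Hy). auto. }
  exists (k + m0), Om', le', (fun w => firstn k w). split; [|split; [|split]].
  - split; [trivial|].
    assert (Hne : exists w, Om' w).
    { destruct (base_refine X x) as (p & Hp & _); [apply Htop|trivial|].
      destruct (Hcl u0 p Hu0 Hp) as (v & Hv & _ & Hb). exists (v ++ p). auto. }
    assert (Htr' : forall u v w, Om' u -> Om' v -> Om' w -> le' u v -> le' v w -> le' u w).
    { intros u v w Hu Hv Hw. rewrite !Hle' by trivial. intros [H1 H2] [H3 H4].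
      split; [|auto]. apply (Htr _ (firstn k v)); trivial; now apply Hout. }
    split; [trivial|]. split; [|split; [|split; [trivial|]]].
    + apply (st_ext D_structure (D_pairs (k + m0) (k + m0) (fun u v => Om' u /\ Om' v /\ le' u v)
        ltac:(unfold defVV, le'; defn) ltac:(intros u v ((Hu & _) & (Hv & _) & _); auto))).
      intros z. split.
      * intros (u & v & Hz & Hu & Hv & H). eauto 7.
      * intros (u & v & Hu & Hv & H & Hz). eauto 7.
    + intros u Hu. apply Hle'; trivial. split; [|trivial]. now apply Hrefl, Hout.
    + apply directed_finite; trivial. intros u v Hu Hv.
      destruct (Hout u Hu) as (HOu & Hbu & _), (Hout v Hv) as (HOv & Hbv & _).
      destruct (base_refine (fun y => B (skipn k u) y /\ B (skipn k v) y) x) as (p & Hp & Hpp).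
      { apply Htop; apply B_open; [apply Hbu|apply Hbv]. }
      { split; [apply Hbu|apply Hbv]. }
      destruct (Hdir2 _ _ HOu HOv) as (w & Hw & Hwu & Hwv).
      (* The index [w] need not have its value in the neighbourhood [p]; the cluster property
         supplies [v'] below [w] that does. *)
      destruct (Hcl w p Hw Hp) as (v' & Hv' & Hvw & Hb).
      assert (Hn : Om' (v' ++ p)) by auto. exists (v' ++ p). split; [trivial|].
      rewrite !Hle' by trivial.
      destruct (firstn_skipn_app v' p k (Hk _ Hv')) as [-> ->].
      split; (split; [apply (Htr _ w); trivial|]); intros y Hy; split;
        try (now apply Hpp); [apply Hbu|apply Hbv].
  - split; [trivial|]. split; [intros u Hu; now apply Hout|].
    apply (D_of_definable _ (fun z => Om' (firstn (k + m0) z) /\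
      skipn (k + m0) z = firstn k z)).
    + apply definable_and; [defn|].
      apply (definable_eq_vec _ k (fun z => skipn (k + m0) z) (fun z => firstn k z)); tmap.
    + intros z. split.
      * intros (u & Hu & ->). assert (Hl : length u = k + m0) by apply Hu.
        destruct (firstn_skipn_app u (firstn k u) _ Hl) as [-> ->].
        split; [rewrite length_app, length_firstn; lia|]. split; [trivial|].
        rewrite firstn_app. replace (k - length u) with 0 by lia. simpl.
        now rewrite app_nil_r.
      * intros (Hl & HO & E). exists (firstn (k + m0) z). split; [trivial|].
        rewrite firstn_firstn. replace (min k (k + m0)) with k by lia.
        rewrite <- E. now rewrite firstn_skipn.
  - intros u Hu. destruct (base_refine X x) as (p & Hp & _); [apply Htop|trivial|].
    destruct (Hcl u p Hu Hp) as (v & Hv & Hvu & Hb).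
    assert (Hn : Om' (v ++ p)) by auto. exists (v ++ p). split; [trivial|].
    intros w Hw. rewrite Hle' by trivial.
    destruct (firstn_skipn_app v p k (Hk _ Hv)) as [-> ->]. intros [H _].
    apply (Htr _ v); trivial. now apply Hout.
  - exists x. split; [trivial|]. intros A (_ & _ & U & HU & HUx & HUA).
    destruct (base_refine U x HU HUx) as (p & Hp & HpU).
    destruct (Hcl u0 p Hu0 Hp) as (v & Hv & _ & Hb).
    assert (Hn : Om' (v ++ p)) by auto. exists (v ++ p). split; [trivial|].
    intros w Hw. rewrite Hle' by trivial.
    destruct (firstn_skipn_app v p k (Hk _ Hv)) as [-> ->]. intros [_ H].
    apply HUA, HpU, H. now apply Hout.
Qed.

End Theory.

Theorem theorem4p6 (M : Type) (lt : M -> M -> Prop) (add : M -> M -> M)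
    (zero : M) (opp : M -> M) (D : nat -> pset M -> Prop)
    (HM : DC_loc_omin_expansion lt add zero opp D)
    (n : nat) (X : pset M) (tau : pset M -> Prop)
    (HX : def_top_space D n X tau) :
  (cond_curves lt D n X tau <-> cond_nets D n X tau) /\
  (cond_nets D n X tau <-> cond_filtered D n X tau).
Proof.
  destruct HX as (HXd & Htop & m & T & B & HB & Hopen & Hbase).
  pose proof (@filtered_of_curves M lt add zero opp D HM n X tau HXd Htop) as H13.
  pose proof (@filtered_of_nets M lt add zero opp D HM n X tau HXd) as H23.
  pose proof (@curves_of_filtered M lt add zero opp D HM n X tau HXd Htop m T B HB Hopen Hbase)
    as H31.
  pose proof (@nets_of_filtered M lt add zero opp D HM n X tau HXd Htop m T B HB Hopen Hbase)
    as H32.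
  tauto.
Qed.
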